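(* Let $\Psi:(0,\infty)\to(0,\infty)$ and $\omega:(0,\infty)\to(0,1)$ be such that $q\mapsto q^{2}\Psi(q)$ and $q\mapsto q^{2}\Psi(q)\omega(q)$ are non-increasing, $\Psi$ satisfies the square divisibility condition, $\sum_{q=1}^{\infty}q\Psi(q)<\infty$, and $\lim_{q\to\infty}\omega(q)=0$. Assume also that $$\omega(q)\geq\frac{45}{16\Psi(q)}\Psi\left(\frac{1}{8\Psi(q)}\right)$$ for all $q$ sufficiently large. Then $$\dim_H(E(\Psi,\omega))=\inf\left\{s\ge 0:\sum_{q=1}^{\infty}q(\Psi(q)\omega(q))^{s}<\infty\right\}.$$
   Context: $\Psi$ satisfies the square divisibility condition if for every $q\in\mathbb{N}$, $\Psi(q)^{-1}$ is an integer divisible by $q^{2}$. $\dim_H$ denotes Hausdorff dimension. $W(\Psi)$ denotes the set of $x\in\mathbb{R}$ with $|x-p/q|\le\Psi(q)$ for infinitely many $(p,q)\in\mathbb{Z}\times\mathbb{N}$. $E(\Psi,\omega)$ denotes the set of $x\in W(\Psi)$ such that for all $q\in\mathbb{N}$ sufficiently large, $|x-p/q|\ge(1-\omega(q))\Psi(q)$ for all $p\in\mathbb{Z}$. *)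

(* Defs.v *)
From HB Require Import structures.
From mathcomp Require Import all_boot all_order all_algebra.
From mathcomp Require Import all_classical all_reals all_analysis.

Set Implicit Arguments.
Unset Strict Implicit.
Unset Printing Implicit Defensive.
Import Order.TTheory GRing.Theory Num.Theory.
Import numFieldNormedType.Exports.

Local Open Scope classical_set_scope.
Local Open Scope ring_scope.

Section hausdorff.
Variable R : realType.
Implicit Types (A U : set R) (s delta : R).

Definition diam U : \bar R := ereal_sup [set `|x - y|%:E | x in U & y in U].

(* The guard is the convention diam(set0)^s = 0 (also for s = 0), so that
   empty sets contribute nothing to a cover. For a singleton and s = 0,
   0 `^ 0 = 1, so that the 0-dimensional measure is the counting measure. *)
Definition diam_pow s U : \bar R :=
  if U == set0 then 0%E else (diam U `^ s)%E.

Definition hausdorff_premeasure s delta A : \bar R :=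
  ereal_inf [set (\sum_(i <oo) diam_pow s (U i))%E | U in
    [set U : (set R)^nat | A `<=` \bigcup_i U i /\
                           forall i, (diam (U i) <= delta%:E)%E]].

Definition hausdorff_measure s A : \bar R :=
  ereal_sup [set hausdorff_premeasure s delta A | delta in
    [set delta | 0 < delta]].

Definition hausdorff_dim A : \bar R :=
  ereal_inf [set s%:E | s in
    [set s | 0 <= s /\ hausdorff_measure s A = 0%E]].

End hausdorff.

(* Functions on (0, +oo) are represented by functions on R of which only the
   values at positive arguments are used; the natural numbers start at 1. *)
Section exact_approximation.
Variable R : realType.
Implicit Types (f Psi omega : R -> R) (x : R).

Definition nonincreasing_pos f :=
  forall x y, 0 < x -> x <= y -> f y <= f x.

Definition square_divisibility Psi :=
  forall q : nat, (0 < q)%N ->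
    exists n : int, (Psi q%:R)^-1 = n%:~R /\ ((q ^ 2)%N%:Z %| n)%Z.

(* The infinitude is that of pairs (p, q), not of rationals p / q. *)
Definition W_set Psi : set R :=
  [set x | infinite_set [set pq : int * nat | (0 < pq.2)%N /\
             `|x - pq.1%:~R / pq.2%:R| <= Psi pq.2%:R]].

Definition E_set Psi omega : set R :=
  [set x | W_set Psi x /\
    \forall q \near \oo, forall p : int,
      (1 - omega q%:R) * Psi q%:R <= `|x - p%:~R / q%:R|].

End exact_approximation.

(* Main.v *)
Require Import Defs.
From HB Require Import structures.
From mathcomp Require Import all_boot all_order all_algebra.
From mathcomp Require Import all_classical all_reals all_analysis.
From mathcomp Require Import ring lra zify.

Set Implicit Arguments.
Unset Strict Implicit.
Unset Printing Implicit Defensive.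
Import Order.TTheory GRing.Theory Num.Theory.
Import numFieldNormedType.Exports.

Local Open Scope classical_set_scope.
Local Open Scope ring_scope.

(* The upper bound covers E by the two halves of the annuli
   (1 - omega(q)) Psi(q) <= |x - p/q| <= Psi(q), of length r(q) = Psi(q) omega(q).

   For the lower bound, attach to a rational c of denominator q the window [y - r(q), y]
   with y = c + Psi(q).  Square divisibility makes y itself a rational, of denominator
   N = 1 / Psi(q), and every other rational u of denominator d > q is far from y on the scale
   of Psi(d) as soon as c is isolated from the rationals of denominator at most q.  So the balls
   B(u, 4 Psi(d)) cover little of the window: the ball at y is small compared to r(q) by the
   hypothesis on omega, the others by the convergence of the sum of q Psi(q).  What is left
   contains, by Dirichlet's theorem, of the order of r(q) Q^2 isolated rationals c' of
   denominator about Q, whose windows lie in that of c and avoid the balls.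

   Given a cover (U_i) with small sum of diam(U_i)^t, an averaging argument selects c' so that the
   sum restricted to the U_i meeting its window is at most (beta r(q'))^t whenever it was for c.
   Hence the point common to the successive windows is in E and in none of the U_i: no measure is
   ever constructed. *)

(** * Rationals on the line: separation, counting, covering, Dirichlet *)

Section rationals.
Variable R : realType.
Implicit Types (u v : rat) (x y a b : R).

(** The obstacle lies in the rationals [u] with [den u] between [q] and roughly [r q ^ (-1/2)].
    Counting still allows one of them near the window, and its [psi (den u)] may far exceed [r q],
    so neither counting nor the convergence of the sum limits the damage. Square divisibility
    excludes them: an approximation [u] to [y] produces a rational of small denominator near [c].
    Hence isolation of [c], which can be imposed when [c] is chosen, becomes separation from [y].

    The selection compares the number of children, about [r q * 4 ^ J], with two costs. One is paid
    by the sum of the [d i ^ t] and is of order [(r q / r (2 ^ J)) ^ t]; the other is paid by the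
    total length of the [U i], at most [beta * r q] because [t <= 1]. The first is negligible for a
    suitable [J] since [4 ^ J * r (2 ^ J) ^ t] is unbounded; this is the form in which divergence of
    the series enters. Unboundedness suffices, as [J] is chosen anew, and as large as needed, at
    each step. *)

Definition den u : nat := `|denq u|%N.

Lemma den_gt0 u : (0 < den u)%N.
Proof. by rewrite /den absz_gt0 denq_neq0. Qed.

Lemma den_ge1 u : 1 <= (den u)%:R :> R.
Proof. by rewrite ler1n den_gt0. Qed.

Lemma denR_gt0 u : 0 < (den u)%:R :> R.
Proof. by rewrite ltr0n den_gt0. Qed.

Lemma ratr_num_den u : ratr u = (numq u)%:~R / (den u)%:R :> R.
Proof.
rewrite /ratr; congr (_ / _).
by rewrite /den -[in LHS](gez0_abs (ltW (denq_gt0 u))).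
Qed.

Lemma num_div (p : int) (d : nat) (u : rat) : (0 < d)%N ->
  ratr u = p%:~R / d%:R :> R -> p * (den u)%:Z = numq u * d%:Z.
Proof.
move=> d0 e; apply/eqP; rewrite -(eqr_int R) !rmorphM /=.
have := e; rewrite ratr_num_den => /eqP.
have dN0 : d%:R != 0 :> R by rewrite pnatr_eq0 -lt0n.
have uN0 : (den u)%:R != 0 :> R by rewrite pnatr_eq0 -lt0n den_gt0.
by rewrite eqr_div // -!pmulrn eq_sym mulrC eq_sym => /eqP ->; rewrite mulrC.
Qed.

Lemma dvdn_den (p : int) (d : nat) (u : rat) : (0 < d)%N ->
  ratr u = p%:~R / d%:R :> R -> (den u %| d)%N.
Proof.
move=> d0 /(num_div d0) /(congr1 absz); rewrite !abszM /= => e.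
rewrite -(@Gauss_dvdr _ `|numq u|%N); last by rewrite coprime_sym coprime_num_den.
by rewrite -e dvdn_mull.
Qed.

Lemma frac_rat (p : int) (d : nat) : (0 < d)%N ->
  exists u, ratr u = p%:~R / d%:R :> R.
Proof.
move=> d0; exists (p%:~R / d%:R).
by rewrite fmorph_div /= ratr_int rmorph_nat.
Qed.

Lemma frac_sep (p p' : int) (d d' : nat) : (0 < d)%N -> (0 < d')%N ->
  p%:~R / d%:R != p'%:~R / d'%:R :> R ->
  1 / (d%:R * d'%:R) <= `|p%:~R / d%:R - p'%:~R / d'%:R| :> R.
Proof.
move=> d0 d'0 ne.
have D0 : 0 < d%:R :> R by rewrite ltr0n.
have D'0 : 0 < d'%:R :> R by rewrite ltr0n.
have -> : p%:~R / d%:R - p'%:~R / d'%:R =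
          (p * d'%:Z - p' * d%:Z)%:~R / (d%:R * d'%:R) :> R.
  by rewrite rmorphB !rmorphM /=; field; rewrite !gt_eqF.
rewrite normrM [X in _ <= _ * X]gtr0_norm ?invr_gt0 ?mulr_gt0//.
rewrite ler_pM2r ?invr_gt0 ?mulr_gt0//.
rewrite -intr_norm -[leLHS]mulr1z ler_int -gtz0_ge1 normr_gt0.
apply: contra ne => /eqP e; rewrite eqr_div ?lt0r_neq0//.
by move: e => /eqP; rewrite subr_eq0 -(eqr_int R) !rmorphM /= => /eqP ->.
Qed.

Lemma rat_sep u v : u != v ->
  1 / ((den u)%:R * (den v)%:R) <= `|ratr u - ratr v| :> R.
Proof.
move=> uv; rewrite !ratr_num_den frac_sep ?den_gt0// -!ratr_num_den.
by rewrite fmorph_eq.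
Qed.

Lemma rats_between (D : nat) a b :
  exists2 s : seq rat, uniq s &
    forall u, (u \in s) = ((den u <= D)%N && (a <= ratr u <= b)).
Proof.
set B := (Num.bound (`|a| + `|b|)) .
(* Numerators of the wanted rationals have absolute value at most [B * D]; the shift lists these
   integers by natural numbers. *)
pose l : seq rat := [seq (i%:Z - (B * D)%:Z)%:~R / d%:R |
  d <- iota 0 D.+1, i <- iota 0 (B * D).*2.+1].
exists [seq u <- undup l | (den u <= D)%N && (a <= ratr u <= b)].
  by rewrite filter_uniq// undup_uniq.
move=> u; rewrite mem_filter mem_undup.
case: (boolP ((den u <= D)%N && (a <= ratr u <= b))) => [/and3P[uD au ub]|//].
have uB : `|numq u|%N%:R <= (B * D)%:R :> R.
  have -> : `|numq u|%N%:R = `|ratr u| * (den u)%:R :> R.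
    rewrite ratr_num_den normrM [X in _ = _ * X * _]gtr0_norm ?invr_gt0 ?denR_gt0//.
    by rewrite divfK ?gt_eqF ?denR_gt0// -intr_norm natr_absz.
  rewrite natrM ler_pM ?ler_nat//.
  rewrite (@le_trans _ _ (`|a| + `|b|))//; last first.
    by rewrite ltW// /B archi_boundP// addr_ge0.
  rewrite ler_norml; apply/andP; split.
    by rewrite (le_trans _ au)// opprD ler_wnDr ?oppr_le0// lerNl ler_normr lexx orbT.
  by rewrite (le_trans ub)// ler_wpDl// ler_norm.
rewrite ler_nat in uB; rewrite andTb; apply/allpairsP.
have [k ke kl] : exists2 k : nat, numq u = k%:Z - (B * D)%:Z & (k < (B * D).*2.+1)%N.
  exists (absz (numq u + (B * D)%:Z)); move: uB; clear;
    move: (numq u) (B * D)%N => m n; lia.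
exists (den u, k); split => //.
- by rewrite mem_iota.
- by rewrite mem_iota.
- rewrite -[LHS]divq_num_den ke; congr (_%:~R / _).
  by rewrite /den -[in LHS](gez0_abs (ltW (denq_gt0 u))).
Qed.

(** Pigeonhole: [f] numbers the cells of length [g] starting at [a], and two points of one cell are
    less than [g] apart. *)
Lemma size_separated (s : seq R) a (L g : R) : 0 < g -> 0 <= L -> uniq s ->
  {in s, forall x, a <= x <= a + L} ->
  {in s &, forall x y, x != y -> g <= `|x - y|} ->
  (size s)%:R <= 1 + L / g.
Proof.
move=> g0 L0 us sab sep.
pose f x := Num.truncn ((x - a) / g).
have Lg0 : 0 <= L / g by rewrite divr_ge0// ltW.
have f_ge0 x : x \in s -> 0 <= (x - a) / g.
  by move=> /sab/andP[ax _]; rewrite divr_ge0 ?subr_ge0// ltW.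
suff ss : (size s <= (Num.truncn (L / g)).+1)%N.
  rewrite (@le_trans _ _ (Num.truncn (L / g)).+1%:R) ?ler_nat//.
  by rewrite -addn1 natrD addrC lerD2l truncn_le.
rewrite -(size_map f) -(size_iota 0 (Num.truncn (L / g)).+1) uniq_leq_size//.
- rewrite map_inj_in_uniq// => x y xs ys fxy; apply/eqP/negPn/negP => xy.
  have /andP[x1 x2] := truncn_itv (f_ge0 _ xs).
  have /andP[y1 y2] := truncn_itv (f_ge0 _ ys).
  have := sep _ _ xs ys xy; apply/negP; rewrite -ltNge.
  move: x1 x2 y1 y2; rewrite -/(f x) -/(f y) fxy -natr1.
  rewrite !ler_pdivlMr// !ltr_pdivrMr// ltr_norml => *.
  by apply/andP; split; nra.
- move=> _ /mapP[x xs ->]; rewrite mem_iota/= add0n ltnS le_truncn//.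
  by rewrite ler_pM2r ?invr_gt0// lerBlDl; case/andP: (sab _ xs).
Qed.

Lemma size_rats (s : seq rat) (D : nat) a (L : R) : 0 <= L -> (0 < D)%N ->
  uniq s ->
  {in s, forall u, a <= ratr u <= a + L /\ (den u <= D)%N} ->
  (size s)%:R <= 1 + L * D%:R ^+ 2.
Proof.
move=> L0 D0 us sD.
have D'0 : 0 < D%:R :> R by rewrite ltr0n.
have := @size_separated [seq ratr u | u <- s] a L (1 / D%:R ^+ 2).
rewrite size_map div1r invrK; apply => //.
- by rewrite invr_gt0 exprn_gt0.
- by rewrite map_inj_uniq//; exact: fmorph_inj.
- by move=> _ /mapP[u us' ->]; case: (sD _ us').
- move=> _ _ /mapP[u us' ->] /mapP[v vs ->]; rewrite fmorph_eq => uv.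
  apply: le_trans (rat_sep uv); rewrite div1r lef_pV2 ?posrE ?mulr_gt0 ?denR_gt0 ?exprn_gt0//.
  rewrite expr2 ler_pM// ler_nat.
    by case: (sD _ us').
  by case: (sD _ vs).
Qed.

(** Finite subadditivity of Lebesgue measure. It is used in reverse: if some of the balls are short
    in total, the remaining ones must be numerous. *)
Lemma cover_length (T : choiceType) (s : seq T) (c r : T -> R) a b : a <= b ->
  {in s, forall i, 0 <= r i} ->
  (forall z, a <= z <= b -> exists2 i, i \in s & `|z - c i| <= r i) ->
  b - a <= \sum_(i <- s) 2 * r i.
Proof.
move=> ab r0 cov.
pose A i : set (measurableTypeR R) := `[c i - r i, c i + r i]%classic.
have muA i : i \in s -> lebesgue_measure (A i) = (2 * r i)%:E.
  move=> /r0 ri; rewrite /A lebesgue_measure_itv/= lte_fin.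
  case: ifPn; first by move=> _; rewrite -EFinB; congr _%:E; lra.
  by rewrite -leNgt => h; congr _%:E; lra.
have mA i : measurable (A i) by exact: measurable_itv.
have mU (t : seq T) : measurable (\big[setU/set0]_(i <- t) A i).
  by apply: bigsetU_measurable.
have leU (t : seq T) : {subset t <= s} ->
    (lebesgue_measure (\big[setU/set0]_(i <- t) A i) <= (\sum_(i <- t) 2 * r i)%:E)%E.
  elim: t => [|i t ih] ts; first by rewrite !big_nil measure0.
  rewrite !big_cons EFinD; apply: (le_trans (measureU2 lebesgue_measure (mA i) (mU t))).
  rewrite leeD//; first by rewrite -muA// ts// mem_head.
  by apply: ih => j jt; rewrite ts// in_cons jt orbT.
rewrite -lee_fin; apply: le_trans (leU s _) => //.
have -> : ((b - a)%:E = lebesgue_measure (`[a, b]%classic : set R))%E.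
  rewrite lebesgue_measure_itv/= lte_fin; case: ifPn => [_|]; first by rewrite EFinB.
  rewrite -leNgt => h; have -> : b = a by apply: le_anti; rewrite h ab.
  by rewrite subrr.
apply: le_measure; rewrite ?inE; [exact: measurable_itv|exact: mU|].
move=> z /=; rewrite in_itv/= => /cov[i si zi].
rewrite -bigcup_seq; exists i => //=.
by rewrite /A/= in_itv/= -ler_distlC distrC.
Qed.

(** Pigeonhole on the fractional parts of [i * x] for [i <= Q]. Passing to the reduced denominator
    only weakens the bound. *)
Lemma dirichlet x (Q : nat) : (0 < Q)%N ->
  exists2 u, (den u <= Q)%N & `|x - ratr u| <= 1 / ((den u)%:R * Q%:R).
Proof.
move=> Q0.
have Q'0 : 0 < Q%:R :> R by rewrite ltr0n.
pose fr (i : nat) : R := i%:R * x - (Num.floor (i%:R * x))%:~R.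
have fr0 i : 0 <= fr i by rewrite subr_ge0; case/andP: (floor_itv (i%:R * x)).
have fr1 i : fr i < 1 by rewrite ltrBlDl -[1]/(1%:~R) -intrD; case/andP: (floor_itv (i%:R * x)).
pose f (i : nat) := Num.truncn (Q%:R * fr i).
have Qfr i : 0 <= Q%:R * fr i by rewrite mulr_ge0// ltW.
have [i [j [ij jQ fij]]] : exists i j, [/\ (i < j)%N, (j <= Q)%N & f i = f j].
  apply: contrapT => no.
  have : (size [seq f i | i <- iota 0 Q.+1] <= size (iota 0 Q))%N.
    apply: uniq_leq_size.
      rewrite map_inj_in_uniq ?iota_uniq// => i j.
      rewrite !mem_iota/= !add0n !ltnS => iQ jQ fij.
      apply: contrapT => /eqP; rewrite neq_ltn => /orP[ij|ji]; apply: no.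
        by exists i, j.
      by exists j, i.
    move=> _ /mapP[i _ ->]; rewrite mem_iota/= add0n truncn_lt_nat//.
    by rewrite gtr_pMr.
  by rewrite size_map !size_iota ltnn.
pose d := (j - i)%N.
have d0 : (0 < d)%N by rewrite subn_gt0.
have d'0 : 0 < d%:R :> R by rewrite ltr0n.
pose p := Num.floor (j%:R * x) - Num.floor (i%:R * x).
have [u ue] := frac_rat p d0.
have ud : (den u <= d)%N by apply: dvdn_leq => //; apply: dvdn_den ue.
exists u; first by rewrite (leq_trans ud)// (leq_trans (leq_subr _ _)).
rewrite ue.
apply: (@le_trans _ _ (1 / (d%:R * Q%:R))); last first.
  rewrite !div1r lef_pV2 ?posrE ?mulr_gt0 ?denR_gt0// ler_pM2r// ler_nat//.
have -> : x - p%:~R / d%:R = (fr j - fr i) / d%:R.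
  rewrite /fr /p rmorphB/= /d natrB 1?ltnW//; field.
  by rewrite -natrB 1?ltnW// gt_eqF.
rewrite normrM [X in _ * X <= _]gtr0_norm ?invr_gt0// ler_pdivrMr//.
have -> : 1 / (d%:R * Q%:R) * d%:R = 1 / Q%:R :> R by field; rewrite !gt_eqF.
rewrite ler_pdivlMr// -[X in _ * X <= _](gtr0_norm Q'0) -normrM.
have /andP[x1 x2] := truncn_itv (Qfr i).
have /andP[y1 y2] := truncn_itv (Qfr j).
move: x1 x2 y1 y2; rewrite -/(f i) -/(f j) fij -natr1 ler_norml => *.
by apply/andP; split; lra.
Qed.

End rationals.

(** * Condensation of the convergent sum along powers of two *)

Lemma sum_tail_le (R : realType) (u : nat -> R) (S : R) :
  (forall n, 0 <= u n) -> (forall n, \sum_(0 <= j < n) u j <= S) ->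
  forall e, 0 < e -> exists j0, forall n, \sum_(j0 <= j < n) u j <= e.
Proof.
move=> u0 uS e e0.
pose A : set R := [set \sum_(0 <= j < n) u j | n in [set: nat]].
have hA : has_sup A.
  split; first by exists (\sum_(0 <= j < 0) u j), 0%N.
  by exists S => _ [n _ <-].
have [_ [j0 _ <-] hj] := sup_adherent e0 hA.
exists j0 => n; have [nj|jn] := leqP n j0; first by rewrite big_geq// ltW.
have := ub_le_sup (proj2 hA) (ex_intro2 _ _ n I erefl).
by rewrite (big_cat_nat (leq0n j0) (ltnW jn))//=; lra.
Qed.

Section dyadic.
Variables (R : realType) (psi : nat -> R) (S : R).
Hypothesis psi_gt0 : forall d, (0 < d)%N -> 0 < psi d.
Hypothesis psi_mono : forall d e, (0 < d)%N -> (d <= e)%N ->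
  e%:R ^+ 2 * psi e <= d%:R ^+ 2 * psi d.
Hypothesis psi_sum : forall n, \sum_(1 <= q < n) q%:R * psi q <= S.

Definition hpsi d : R := d%:R ^+ 2 * psi d.

Lemma hpsi_ge0 d : 0 <= hpsi d.
Proof.
rewrite /hpsi; case: d => [|d]; first by rewrite expr0n mul0r.
by rewrite mulr_ge0 ?sqr_ge0// ltW ?psi_gt0.
Qed.

Lemma psiE d : (0 < d)%N -> psi d = hpsi d / d%:R ^+ 2.
Proof. by move=> d0; rewrite /hpsi mulrAC divff ?mul1r// sqrf_eq0 pnatr_eq0 -lt0n. Qed.

Lemma psi_le d e : (0 < d)%N -> (d <= e)%N -> psi e <= psi d.
Proof.
move=> d0 de; have e0 := leq_trans d0 de.
rewrite !psiE//; apply: ler_pM => //; rewrite ?hpsi_ge0 ?invr_ge0 ?sqr_ge0//.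
  exact: psi_mono.
by rewrite lef_pV2 ?posrE ?exprn_gt0 ?ltr0n// lerXn2r ?nnegrE// ler_nat.
Qed.

(** Cauchy condensation: [q * psi q = hpsi q / q] is at least [hpsi (2 ^ n.+1) / 2 ^ n.+1] on the
    [2 ^ n] integers of a block, which gives half of [hpsi (2 ^ n.+1)]. *)
Lemma dyadic_sum_le n :
  \sum_(0 <= j < n) hpsi (2 ^ j.+1) <= 2 * \sum_(1 <= q < 2 ^ n) q%:R * psi q.
Proof.
elim: n => [|n ih]; first by rewrite !big_geq// mulr0.
rewrite big_nat_recr//= (@big_cat_nat _ _ _ (2 ^ n) 1 (2 ^ n.+1))//=; last 2 first.
- by rewrite expn_gt0.
- by rewrite leq_exp2l.
rewrite mulrDr lerD// -ler_pdivrMl//.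
have -> : 2^-1 * hpsi (2 ^ n.+1) =
    \sum_(2 ^ n <= q < 2 ^ n.+1) (hpsi (2 ^ n.+1) / (2 ^ n.+1)%:R).
  have e : (2 ^ n.+1 - 2 ^ n = 2 ^ n)%N by rewrite expnS mul2n -addnn addnK.
  rewrite sumr_const_nat e -mulr_natr expnS natrM.
  by field; rewrite pnatr_eq0 -lt0n expn_gt0.
apply: ler_sum_nat => q /andP[nq qn].
have q0 : (0 < q)%N by rewrite (leq_trans _ nq)// expn_gt0.
have -> : q%:R * psi q = hpsi q / q%:R.
  by rewrite /hpsi; field; rewrite pnatr_eq0 -lt0n.
apply: ler_pM; rewrite ?hpsi_ge0 ?invr_ge0//; first exact/psi_mono/ltnW.
by rewrite lef_pV2 ?posrE ?ltr0n ?expn_gt0// ler_nat ltnW.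
Qed.

Lemma dyadic_tail e : 0 < e ->
  exists j0, forall n, \sum_(j0 <= j < n) hpsi (2 ^ j) <= e.
Proof.
move=> e0; have [|j0 hj0] := @sum_tail_le R (fun j => hpsi (2 ^ j.+1)) (2 * S)
    (fun=> hpsi_ge0 _) _ e e0.
  by move=> n; apply: le_trans (dyadic_sum_le n) _; rewrite ler_pM2l.
exists j0.+1 => -[|n]; first by rewrite big_geq// ltW.
by rewrite big_add1/= hj0.
Qed.

(** A summable non-increasing sequence is [o(1 / n)]: at least [n / 2] terms not below the last one
    lie in a small tail. The factor [n] will absorb the number of dyadic levels of denominators. *)
Lemma mul_hpsi_exp2 e : 0 < e ->
  \forall n \near \oo, n%:R * hpsi (2 ^ n) <= e.
Proof.
move=> e0; have e2 : 0 < e / 2 by rewrite divr_gt0.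
have [j0 hj0] := dyadic_tail e2.
near=> n.
have jn : (j0.*2 <= n)%N by near: n; exact: nbhs_infty_ge.
have : n%:R / 2 * hpsi (2 ^ n) <= e / 2.
  apply: le_trans (hj0 n).
  have : \sum_(j0 <= j < n) hpsi (2 ^ n) <= \sum_(j0 <= j < n) hpsi (2 ^ j).
    apply: ler_sum_nat => j /andP[_ jn'].
    by apply: psi_mono; rewrite ?expn_gt0// leq_exp2l// ltnW.
  apply: le_trans; rewrite sumr_const_nat -[leRHS]mulr_natl ler_wpM2r ?hpsi_ge0//.
  rewrite ler_pdivrMr// -natrM ler_nat; lia.
lra.
Unshelve. all: by end_near. Qed.

Lemma hpsi_small e : 0 < e -> \forall d \near \oo, hpsi d <= e.
Proof.
move=> e0; have [n0 _ hn0] := mul_hpsi_exp2 e0.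
near=> d.
have hd : (2 ^ n0.+1 <= d)%N by near: d; exact: nbhs_infty_ge.
apply: le_trans (hn0 n0.+1 _) => //=.
apply: (@le_trans _ _ (hpsi (2 ^ n0.+1))); first by apply: psi_mono; rewrite ?expn_gt0.
by rewrite ler_peMl ?hpsi_ge0// ler1n.
Unshelve. all: by end_near. Qed.

Lemma mul_hpsi_shift (k : nat) e : 0 < e ->
  \forall n \near \oo, n%:R * hpsi (2 ^ (n - k)) <= e.
Proof.
move=> e0; have e2 : 0 < e / 2 by rewrite divr_gt0.
have [n0 _ hn0] := mul_hpsi_exp2 e2.
near=> n.
have nn : (n0 + k.*2 <= n)%N by near: n; exact: nbhs_infty_ge.
have /hn0/= h : (n0 <= n - k)%N by lia.
apply: (@le_trans _ _ ((2 * (n - k))%:R * hpsi (2 ^ (n - k)))).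
  by rewrite ler_wpM2r ?hpsi_ge0// ler_nat; lia.
rewrite natrM; lra.
Unshelve. all: by end_near. Qed.

End dyadic.

(** * Geometric sums and sums over dyadic blocks of denominators *)

Lemma exp4E (R : realType) n : 4 ^+ n = (2 ^+ n) ^+ 2 :> R.
Proof. by rewrite expr2 -exprMn -natrM. Qed.

Lemma sum_exp2_le (R : realType) n : \sum_(0 <= j < n) 2 ^+ j <= 2 ^+ n :> R.
Proof.
elim: n => [|n ih]; first by rewrite big_geq// expr0.
by rewrite big_nat_recr//= [leRHS]exprS; lra.
Qed.

Lemma sum_exp2V_le (R : realType) n :
  \sum_(0 <= j < n) (2 ^+ j)^-1 <= 2 - 2 / 2 ^+ n :> R.
Proof.
elim: n => [|n ih]; first by rewrite big_geq// expr0; lra.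
rewrite big_nat_recr//= (le_trans (lerD ih (lexx _)))// exprS invfM; lra.
Qed.

Lemma exp2V_small (R : realType) (e : R) : 0 < e ->
  \forall n \near \oo, 1 / 2 ^+ n <= e.
Proof.
move=> e0; near=> n.
have hn : (Num.bound (1 / e) <= n)%N by near: n; exact: nbhs_infty_ge.
rewrite ler_pdivrMr ?exprn_gt0// mulrC -ler_pdivrMr//.
have e1 : 0 <= 1 / e by rewrite divr_ge0// ltW.
apply: le_trans (ltW (archi_boundP e1)) _.
by rewrite -natrX ler_nat (leq_trans hn)// ltnW// ltn_expl.
Unshelve. all: by end_near. Qed.

(** By [size_rats], the block of denominators below [2 ^ j.+1] has at most [1 + L * (2 ^ j.+1) ^ 2]
    elements, whence the factor [1 + 4 * L * 4 ^ j]. *)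
Lemma sum_dyadic_blocks (R : realType) (f : rat -> R) (F : nat -> R) (a L : R)
    (j0 k : nat) (s : seq rat) : 0 <= L -> (forall j, 0 <= F j) ->
  (forall u j, (2 ^ j <= den u)%N -> (den u < 2 ^ j.+1)%N -> f u <= F j) ->
  uniq s ->
  {in s, forall u, [/\ a <= ratr u <= a + L, (2 ^ j0 <= den u)%N &
                       (den u < 2 ^ (j0 + k))%N]} ->
  \sum_(u <- s) f u <= \sum_(j0 <= j < j0 + k) (1 + 4 * L * 4 ^+ j) * F j.
Proof.
move=> L0 F0 fF; elim: k s => [|k ih] s us sP.
  rewrite addn0 [leRHS]big_geq// big_seq big1// => u /sP[_ h1].
  by rewrite addn0 ltnNge h1.
rewrite addnS big_nat_recr ?leq_addr//= (bigID (fun u => (den u < 2 ^ (j0 + k))%N))/=.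
apply: lerD.
  rewrite -big_filter; apply: ih; first exact: filter_uniq.
  by move=> u; rewrite mem_filter => /andP[? /sP[]].
rewrite -big_filter; set t := [seq _ <- s | _].
have ut : uniq t by exact: filter_uniq.
apply: (@le_trans _ _ (\sum_(u <- t) F (j0 + k)%N)).
  rewrite big_seq [leRHS]big_seq; apply: ler_sum => u.
  rewrite mem_filter -leqNgt => /andP[h1 /sP[_ _ h2]].
  by apply: fF; rewrite // -addnS.
rewrite big_const_seq count_predT iter_addr_0 -[leLHS]mulr_natl ler_wpM2r//.
have -> : 4 * L * 4 ^+ (j0 + k) = L * (2 ^ (j0 + k).+1)%:R ^+ 2.
  by rewrite exp4E natrX (exprS 2 (j0 + k)); ring.
apply: (@size_rats R t _ a) => //; first by rewrite expn_gt0.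
move=> u; rewrite mem_filter => /andP[_ /sP[h1 _ h2]].
by split => //; rewrite ltnW// -addnS.
Qed.

(** * Abundance of isolated rationals *)

Section count.
Variables (R : realType) (psi : nat -> R) (S : R).
Hypothesis psi_gt0 : forall d, (0 < d)%N -> 0 < psi d.
Hypothesis psi_mono : forall d e, (0 < d)%N -> (d <= e)%N ->
  e%:R ^+ 2 * psi e <= d%:R ^+ 2 * psi d.
Hypothesis psi_sum : forall n, \sum_(1 <= q < n) q%:R * psi q <= S.
Local Notation h := (hpsi psi).

(** For [den u = den c] the radius is [K * psi (den c)], and it grows as [den u] decreases. Each
    dyadic level of denominators then takes a share of order [h (den c)] of an interval, so all
    levels together take little, by [mul_hpsi_shift]. *)
Definition isolated_rat (K : R) (c : rat) := forall u, u != c ->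
  (den u <= den c)%N -> K * h (den c) / (den u)%:R ^+ 2 <= `|ratr c - ratr u|.

(** The first summand contributes about [K * h] per dyadic level, and [J * h] is small. The second
    one sums to a geometric series dominated by its last level. The centres range over a threefold
    interval because balls meeting the interval may be centred outside it. *)
Lemma isolation_sum (K a b : R) : 0 < K -> a < b ->
  \forall J \near \oo, forall s, uniq s ->
    {in s, forall u, a - (b - a) <= ratr u <= b + (b - a) /\ (den u < 2 ^ (J - 10))%N} ->
    \sum_(u <- s) 2 * (K * h (2 ^ (J - 10)) / (den u)%:R ^+ 2 +
                       1 / ((den u)%:R * (2 ^ J)%:R)) <= (b - a) / 8.
Proof.
move=> K0 ab; set D := b - a; have D0 : 0 < D by rewrite subr_gt0.
have e1 : 0 < D / (64 * K * (1 + 12 * D)).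
  by rewrite divr_gt0// !mulr_gt0//; lra.
have e2 : 0 < D / 256 by lra.
near=> J.
have J10 : (10 <= J)%N by near: J; exact: nbhs_infty_ge.
have hJ : J%:R * h (2 ^ (J - 10)) <= D / (64 * K * (1 + 12 * D)).
  by near: J; exact: (mul_hpsi_shift psi_gt0 psi_mono psi_sum).
have JV : 1 / 2 ^+ J <= D / 256 by near: J; exact: exp2V_small.
move=> s us sP.
set n := (J - 10)%N in sP hJ *.
set H := h (2 ^ n) in hJ *.
have H0 : 0 <= H by exact: hpsi_ge0.
have KH0 : 0 <= K * H by rewrite mulr_ge0// ltW.
pose F j : R := 2 * (K * H / 4 ^+ j + 1 / (2 ^+ j * 2 ^+ J)).
have F0 j : 0 <= F j.
  by rewrite mulr_ge0// addr_ge0// divr_ge0// ?mulr_ge0 ?exprn_ge0.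
apply: le_trans (@sum_dyadic_blocks R _ F (a - D) (3 * D) 0 n s _ F0 _ us _) _.
- by rewrite mulr_ge0// ltW.
- move=> u j h1 _; rewrite /F ler_pM2l// natrX.
  have p1 : 0 < 2 ^+ j :> R by rewrite exprn_gt0.
  have p2 : 2 ^+ j <= (den u)%:R :> R by rewrite -natrX ler_nat.
  rewrite exp4E.
  rewrite lerD//.
    rewrite ler_wpM2l// lef_pV2 ?posrE ?exprn_gt0 ?denR_gt0//.
    by rewrite lerXn2r// nnegrE ltW// denR_gt0.
  rewrite !div1r lef_pV2 ?posrE ?mulr_gt0 ?exprn_gt0 ?denR_gt0//.
  by rewrite ler_pM2r// exprn_gt0.
- move=> u /sP[/andP[h1 h2] h3]; split => //.
    by rewrite h1 (le_trans h2)// /D; lra.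
  exact: den_gt0.
rewrite add0n.
apply: (@le_trans _ _ (\sum_(0 <= j < n) (2 * K * H * (1 + 12 * D) +
    2 * (1 / 2 ^+ J) * (2 ^+ j)^-1 + 24 * D * (1 / 2 ^+ J) * 2 ^+ j))).
  apply: ler_sum_nat => j _; rewrite /F.
  have p1 : 1 <= 2 ^+ j :> R by rewrite exprn_ege1// ler1n.
  have p3 : 0 < 2 ^+ J :> R by rewrite exprn_gt0.
  rewrite exp4E.
  move: p1 p3; set x := 2 ^+ j; set y := 2 ^+ J => p1 p3.
  have -> : (1 + 4 * (3 * D) * x ^+ 2) * (2 * (K * H / x ^+ 2 + 1 / (x * y))) =
    2 * K * H * (1 / x ^+ 2 + 12 * D) + 2 * (1 / y) / x + 24 * D * (1 / y) * x.
    by field; rewrite !gt_eqF//; lra.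
  rewrite !lerD2r; apply: ler_wpM2l; first lra.
  have x0 : 0 < x by lra.
  by rewrite lerD2r div1r invf_le1 ?exprn_gt0// (exprn_ege1 2 p1).
rewrite !big_split/= sumr_const_nat subn0 -!mulr_sumr.
have t1 : 2 * K * H * (1 + 12 * D) *+ n <= D / 32.
  rewrite -mulr_natr.
  have : n%:R * H <= D / (64 * K * (1 + 12 * D)).
    by apply: le_trans hJ; rewrite ler_wpM2r// ler_nat leq_subr.
  rewrite ler_pdivlMr; last by rewrite !mulr_gt0//; lra.
  lra.
have t2 : 2 * (1 / 2 ^+ J) * \sum_(0 <= j < n) (2 ^+ j)^-1 <= D / 64.
  apply: (@le_trans _ _ (2 * (1 / 2 ^+ J) * 2)); last lra.
  rewrite ler_wpM2l// ?mulr_ge0// ?divr_ge0 ?exprn_ge0//.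
  by apply: le_trans (sum_exp2V_le _ _) _; rewrite gerBl divr_ge0// exprn_ge0.
(* The gap of ten levels is chosen here: [24 / 2 ^ 10] is below [1 / 32]. *)
have t3 : 24 * D * (1 / 2 ^+ J) * \sum_(0 <= j < n) 2 ^+ j <= D / 32.
  have E : 2 ^+ J = 2 ^+ n * 1024 :> R.
    by rewrite -{1}(subnK J10) exprD -/n; congr (_ * _); rewrite -natrX.
  apply: (@le_trans _ _ (24 * D * (1 / 2 ^+ J) * 2 ^+ n)).
    rewrite ler_wpM2l ?sum_exp2_le// !mulr_ge0// ?divr_ge0 ?exprn_ge0//.
    by rewrite ltW.
  have p : 0 < 2 ^+ n :> R by rewrite exprn_gt0.
  have -> : 24 * D * (1 / 2 ^+ J) * 2 ^+ n = 24 / 1024 * D.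
    by rewrite E; field; rewrite gt_eqF.
  lra.
lra.
Unshelve. all: by end_near. Qed.

(** Take [z] outside the balls of radius [4 * psi] around [bad] and of radius [rho] around the
    rationals of denominator below [2 ^ (J - 10)]. Its Dirichlet approximation [c] then has all the
    wanted properties, and [z] lies within [2 ^ 10 / 4 ^ J] of [c]. The two removed families take at
    most 1/2 and 1/8 of the length, so the balls around the good [c] take at least 1/4; this gives
    [2 ^ 13 = 4 * 2 * 2 ^ 10]. *)
Lemma isolated_rats (K a b e : R) : 0 < K -> a < b -> 0 < e ->
  \forall J \near \oo, forall bad : seq rat,
    \sum_(u <- bad) 8 * psi (den u) <= (b - a) / 2 ->
    exists s, [/\ uniq s, (b - a) * 4 ^+ J <= 2 ^+ 13 * (size s)%:R &
      forall c, c \in s -> [/\ (2 ^ (J - 10) <= den c <= 2 ^ J)%N,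
        a - e <= ratr c <= b + e, isolated_rat K c &
        forall u, u \in bad -> u != c -> (den u <= den c)%N ->
          2 * psi (den u) <= `|ratr c - ratr u|]].
Proof.
move=> K0 ab e0; set D := b - a; have D0 : 0 < D by rewrite subr_gt0.
have e1 : 0 < Num.min (D / 2) (1 / 2 ^+ 10) / K.
  by rewrite divr_gt0// lt_min !divr_gt0// exprn_gt0.
have e2 : 0 < Num.min (D / 2) e by rewrite lt_min e0 divr_gt0.
near=> J.
have J10 : (10 <= J)%N by near: J; exact: nbhs_infty_ge.
have hJ : J%:R * h (2 ^ (J - 10)) <= Num.min (D / 2) (1 / 2 ^+ 10) / K.
  by near: J; exact: (mul_hpsi_shift psi_gt0 psi_mono psi_sum).
have JV : 1 / 2 ^+ J <= Num.min (D / 2) e by near: J; exact: exp2V_small.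
have : forall s, uniq s ->
    {in s, forall u, a - D <= ratr u <= b + D /\ (den u < 2 ^ (J - 10))%N} ->
    \sum_(u <- s) 2 * (K * h (2 ^ (J - 10)) / (den u)%:R ^+ 2 +
                       1 / ((den u)%:R * (2 ^ J)%:R)) <= D / 8.
  by near: J; exact: isolation_sum.
set n := (J - 10)%N in hJ *; set H := h (2 ^ n) in hJ *.
(* The first summand is the isolation radius; the second absorbs the Dirichlet error in passing from
   [z] to [c]. *)
set rho := fun u : rat => K * H / (den u)%:R ^+ 2 + 1 / ((den u)%:R * (2 ^ J)%:R).
move=> iso bad badD.
have H0 : 0 <= H by exact: hpsi_ge0.
have KH0 : 0 <= K * H by rewrite mulr_ge0// ltW.
have Q0 : 0 < (2 ^ J)%:R :> R by rewrite ltr0n expn_gt0.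
have EQ : (2 ^ J = 2 ^ n * 1024)%N by rewrite -[in LHS](subnK J10) expnD.
have KH : K * H <= Num.min (D / 2) (1 / 2 ^+ 10).
  rewrite mulrC -ler_pdivlMr//; apply: le_trans hJ; rewrite ler_peMl// ler1n.
  exact: leq_trans J10.
have {KH} [KHD KH10] : K * H <= D / 2 /\ K * H <= 1 / 2 ^+ 10.
  by move: KH; rewrite le_min => /andP[].
have {JV} [JVD JVe] : 1 / (2 ^ J)%:R <= D / 2 /\ 1 / (2 ^ J)%:R <= e.
  by move: JV; rewrite le_min natrX => /andP[].
have inv1 u : 1 / ((den u)%:R * (2 ^ J)%:R) <= 1 / (2 ^ J)%:R :> R.
  rewrite !div1r lef_pV2 ?posrE// ?mulr_gt0 ?denR_gt0//.
  by rewrite ler_peMl ?den_ge1// ltW.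
have rhoD u : rho u <= D.
  have : K * H / (den u)%:R ^+ 2 <= K * H.
    by rewrite ler_pdivrMr ?exprn_gt0 ?denR_gt0// ler_peMr// exprn_ege1// den_ge1.
  by have := inv1 u; rewrite /rho; lra.
have [r0 ur0 r0P] := rats_between (2 ^ n).-1 (a - D) (b + D).
have [r1 ur1 r1P] := rats_between (2 ^ J) (a - e) (b + e).
pose P c := [/\ (2 ^ n <= den c)%N, isolated_rat K c &
  forall u, u \in bad -> u != c -> (den u <= den c)%N ->
    2 * psi (den u) <= `|ratr c - ratr u|].
pose s := [seq c <- r1 | `[< P c >]].
have r0E u : (u \in r0) = ((den u < 2 ^ n)%N && (a - D <= ratr u <= b + D)).
  by rewrite r0P -ltnS prednK// expn_gt0.
exists s; split; first exact: filter_uniq; last first.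
  move=> c; rewrite mem_filter r1P => /and3P[/asboolP[p1 p2 p3] p4 p5].
  by split => //; apply/andP.
pose cov : seq (R * R) := [seq (ratr u, 4 * psi (den u)) | u <- bad] ++
  ([seq (ratr u, rho u) | u <- r0] ++ [seq (ratr u, 2 ^+ 10 / 4 ^+ J) | u <- s]).
have rho0 u : 0 <= rho u.
  by apply: addr_ge0; apply: divr_ge0 => //; rewrite ?exprn_ge0 ?mulr_ge0.
have cov0 : {in cov, forall i, 0 <= i.2}.
  move=> i; rewrite !mem_cat => /or3P[] /mapP[u _ ->].
  - by rewrite mulr_ge0// ltW// psi_gt0// den_gt0.
  - exact: rho0.
  - by rewrite divr_ge0// exprn_ge0.
have := @cover_length R _ cov (fun i => i.1) (fun i => i.2) a b (ltW ab) cov0.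
rewrite !big_cat !big_map/= -/D => main.
have {main} : D <= \sum_(u <- bad) 2 * (4 * psi (den u)) +
    (\sum_(u <- r0) 2 * rho u + \sum_(u <- s) 2 * (2 ^+ 10 / 4 ^+ J)).
  apply: main => z zab; apply: contrapT => nc.
  have ncb u : u \in bad -> 4 * psi (den u) < `|z - ratr u|.
    move=> ub; rewrite ltNge; apply/negP => le; apply: nc.
    exists (ratr u, 4 * psi (den u)) => //=; by rewrite mem_cat map_f.
  have nc0 u : (den u < 2 ^ n)%N -> rho u < `|z - ratr u|.
    move=> un; rewrite ltNge; apply/negP => le; apply: nc.
    exists (ratr u, rho u) => //=; rewrite !mem_cat.
    apply/or3P; apply: Or32; apply/mapP; exists u => //.
    rewrite r0E un/=; have := le_trans le (rhoD u); move: zab; rewrite ler_norml; lra.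
  have [c cJ zc] := @dirichlet R z (2 ^ J) (expn_gt0 _ _).
  have nce : (2 ^ n <= den c)%N.
    rewrite leqNgt; apply/negP => /nc0; apply/negP; rewrite -leNgt.
    by apply: le_trans zc _; rewrite /rho lerDr divr_ge0// exprn_ge0.
  apply: nc; exists (ratr c, 2 ^+ 10 / 4 ^+ J) => //=; last first.
    apply: le_trans zc _; rewrite ler_pdivrMr ?mulr_gt0 ?denR_gt0//.
    rewrite mulrAC ler_pdivlMr ?exprn_gt0// mul1r.
    have -> : 4 ^+ J = (2 ^ J)%:R * (2 ^ J)%:R :> R.
      by rewrite natrX exp4E expr2.
    rewrite mulrA ler_pM2r// {1}EQ natrM -natrX mulrC ler_pM2l ?ltr0n//.
    by rewrite ler_nat.
  rewrite !mem_cat; apply/or3P; apply: Or33; apply/mapP; exists c => //.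
  rewrite mem_filter r1P cJ/=; apply/andP; split; last first.
    by have := le_trans zc (le_trans (inv1 c) JVe); move: zab; rewrite ler_norml; lra.
  have inv2 u : (den u <= den c)%N ->
      1 / ((den c)%:R * (2 ^ J)%:R) <= 1 / ((den u)%:R * (2 ^ J)%:R) :> R.
    move=> uc; rewrite !div1r lef_pV2 ?posrE// ?mulr_gt0 ?denR_gt0//.
    by rewrite ler_pM2r// ler_nat.
  apply/asboolP; split => //.
  (* A violation by [u], compared with [rat_sep], gives [den u < K * H * den c <= 2 ^ n]. So the
     ball around [u] was removed, and yet it would contain [z]. *)
  - move=> u uc duc; rewrite leNgt; apply/negP => lt.
    have hH : h (den c) <= H by apply: psi_mono => //; rewrite expn_gt0.
    have lt1 : `|ratr c - ratr u| < K * H / (den u)%:R ^+ 2.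
      apply: lt_le_trans lt _; rewrite ler_wpM2r ?invr_ge0 ?exprn_ge0//.
      by rewrite ler_wpM2l// ltW.
    have := lt_le_trans (le_lt_trans (rat_sep R uc) _) (lexx _).
    rewrite distrC => /(_ _ lt1); rewrite ltr_pdivlMr ?exprn_gt0 ?denR_gt0//.
    have -> : 1 / ((den u)%:R * (den c)%:R) * (den u)%:R ^+ 2 =
              (den u)%:R / (den c)%:R :> R.
      by field; rewrite !gt_eqF ?denR_gt0.
    rewrite ltr_pdivrMr ?denR_gt0// => lt2.
    have un : (den u < 2 ^ n)%N.
      rewrite -(ltr_nat R); apply: lt_le_trans lt2 _.
      apply: (@le_trans _ _ (1 / 2 ^+ 10 * (2 ^ J)%:R)).
        by apply: ler_pM => //; rewrite ler_nat.
      by rewrite EQ natrM -natrX; lra.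
    have := nc0 _ un; apply/negP; rewrite -leNgt /rho.
    have := inv2 _ duc; have := ler_normD (z - ratr c) (ratr c - ratr u).
    by rewrite addrA subrK; lra.
  (* The Dirichlet error is at most [1 / (den u * den c)], hence at most [|c - u|]; so
     [|c - u| < 2 * psi] would put [z] within [4 * psi] of [u]. *)
  - move=> u ub uc duc; rewrite leNgt; apply/negP => lt.
    have := ncb _ ub; apply/negP; rewrite -leNgt.
    have s1 : 1 / ((den c)%:R * (2 ^ J)%:R) <= 1 / ((den u)%:R * (den c)%:R) :> R.
      rewrite !div1r lef_pV2 ?posrE// ?mulr_gt0 ?denR_gt0// mulrC ler_pM2l ?denR_gt0//.
      by rewrite ler_nat (leq_trans duc).
    have := rat_sep R uc; rewrite distrC.
    have := ler_normD (z - ratr c) (ratr c - ratr u).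
    by rewrite addrA subrK; lra.
have b1 : \sum_(u <- bad) 2 * (4 * psi (den u)) <= D / 2.
  by apply: le_trans badD; apply: ler_sum => u _; rewrite mulrA -natrM.
have b2 : \sum_(u <- r0) 2 * rho u <= D / 8.
  by apply: iso => // u; rewrite r0E => /andP[].
rewrite big_const_seq count_predT iter_addr_0 -[X in _ + (_ + X)]mulr_natl => b3.
have {b1 b2 b3} : D / 4 <= (size s)%:R * (2 * (2 ^+ 10 / 4 ^+ J)) by lra.
rewrite [2 * (_ / _)]mulrA [_ * (_ / _)]mulrA ler_pdivlMr ?exprn_gt0//.
have -> : 2 ^+ 13 = 8192 :> R by rewrite -natrX.
have -> : 2 ^+ 10 = 1024 :> R by rewrite -natrX.
lra.
Unshelve. all: by end_near. Qed.

End count.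

(** * Separation of the endpoint [y] from other rationals *)

Section endpoint.
Variables (R : realType) (psi : nat -> R) (S : R).
Hypothesis psi_gt0 : forall d, (0 < d)%N -> 0 < psi d.
Hypothesis psi_mono : forall d e, (0 < d)%N -> (d <= e)%N ->
  e%:R ^+ 2 * psi e <= d%:R ^+ 2 * psi d.
Hypothesis psi_sum : forall n, \sum_(1 <= q < n) q%:R * psi q <= S.
Local Notation h := (hpsi psi).

(* Writing [c = p / q], [u = p' / d], [A = p' q - p d] and [D = A q m - d], one has
   [u - c = A / (q d)], [u - y = D / (d q^2 m)] for [y = c + psi q], and
   [p D - A = q B] with [B = p A m - p'].  Thus [B / D] is a rational at distance
   [A / (q |D|)] from [c], and the isolation of [c] bounds [d |D|] from below. *)
Lemma endpoint_sep (K : R) (c u : rat) (m : nat) : 0 < K -> K <= m%:R ->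
  psi (den c) = 1 / ((den c)%:R ^+ 2 * m%:R) -> isolated_rat psi K c ->
  (den c < den u)%N ->
  `|ratr u - (ratr c + psi (den c))| <= psi (den c) / 2 ->
  (ratr u = ratr c + psi (den c) /\ (den c ^ 2 * m <= den u)%N) \/
  K / 2 * psi (den u) <= `|ratr u - (ratr c + psi (den c))|.
Proof.
move=> K0 Km psim iso qd near_y.
have m0 : 0 < m%:R :> R by apply: lt_le_trans K0 Km.
have q0 := denR_gt0 R c; have d0 := denR_gt0 R u.
move: (ratr_num_den R c) (ratr_num_den R u).
set q := den c in qd near_y psim q0 *; set d := den u in qd d0 *.
set p := numq c; set p' := numq u => ce ue.
pose A : int := p' * q%:Z - p * d%:Z.
pose D : int := A * q%:Z * m%:Z - d%:Z.
pose B : int := p * A * m%:Z - p'.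
have AE : A%:~R = p'%:~R * q%:R - p%:~R * d%:R :> R by rewrite /A rmorphB !rmorphM.
have DE : D%:~R = A%:~R * q%:R * m%:R - d%:R :> R by rewrite /D rmorphB !rmorphM.
have BE : p * D - A = q%:Z * B by rewrite /D /B /A; ring.
have uc : ratr u - ratr c = A%:~R / (q%:R * d%:R) :> R.
  by rewrite ue ce AE; field; rewrite !gt_eqF.
have uy : ratr u - (ratr c + psi q) = D%:~R / (d%:R * q%:R ^+ 2 * m%:R).
  by rewrite opprD addrA uc psim DE; field; rewrite !gt_eqF.
clearbody D B A.
have Y0 : 0 < d%:R * q%:R ^+ 2 * m%:R :> R by rewrite !mulr_gt0 ?exprn_gt0.
have psiq : psi q = d%:R / (d%:R * q%:R ^+ 2 * m%:R).
  by rewrite psim; field; rewrite !gt_eqF.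
have Dd : `|D%:~R| <= d%:R / 2 :> R.
  move: near_y; rewrite uy psiq normrM [X in _ * X <= _]gtr0_norm ?invr_gt0//.
  by rewrite [leRHS]mulrAC ler_pM2r ?invr_gt0.
have {Dd} [D1 D2] : - (d%:R / 2) <= D%:~R :> R /\ D%:~R <= d%:R / 2 :> R.
  by move: Dd; rewrite ler_norml => /andP[].
have qm0 : 0 < q%:R * m%:R :> R by rewrite mulr_gt0.
have A0 : 0 < A.
  rewrite -(ltr0z R) -(pmulr_lgt0 _ qm0) mulrA; lra.
have A1 : 1 <= A%:~R :> R by rewrite -[1]mulr1z ler_int -gtz0_ge1.
have dA : 2 * (A%:~R * q%:R * m%:R) <= 3 * d%:R :> R by lra.
(* Here [u] is [y] itself: [q] divides [A], so that [d = A * q * m] is at least [q ^ 2 * m]. *)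
have [D0|DN0] := eqVneq D 0.
  left; split.
    by apply/eqP; rewrite -subr_eq0 uy D0 mul0r.
  move: BE; rewrite D0 mulr0 sub0r => BE.
  have B0 : 0 < - B.
    have : 0 < q%:Z * - B by rewrite mulrN -BE opprK.
    by rewrite pmulr_rgt0// ltz_nat den_gt0.
  have qA : q%:R <= A%:~R :> R.
    have -> : A = q%:Z * - B by rewrite mulrN -BE opprK.
    rewrite rmorphM/= ler_peMr//.
    by rewrite -[1]mulr1z ler_int -gtz0_ge1.
  rewrite -(ler_nat R) natrM natrX.
  have -> : d%:R = A%:~R * q%:R * m%:R :> R.
    by apply/eqP; rewrite eq_sym -subr_eq0 -DE D0.
  by rewrite expr2 !ler_pM2r.
right.
have n0 : (0 < `|D|)%N by rewrite absz_gt0.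
have nE : `|D|%N%:R = `|D%:~R| :> R by rewrite natr_absz intr_norm.
have N0 : 0 < `|D%:~R| :> R by rewrite -nE ltr0n.
have key : K * q%:R ^+ 2 / 2 <= d%:R * `|D%:~R|.
  (* If [|D|] exceeds [q], the bound follows from [d >= (2 / 3) * q * m] and [K <= m]. Otherwise
     [B / D] has denominator at most [q], and differs from [c] because [A] is nonzero, so isolation
     applies to it. *)
  have [Dq|qD] := leqP `|D|%N q; last first.
    have {}qD : q%:R <= `|D%:~R| :> R by rewrite -nE ler_nat ltnW.
    apply: (@le_trans _ _ (d%:R * q%:R)); last by rewrite ler_pM2l.
    rewrite expr2 mulrA mulrAC ler_pM2r//.
    have : K * q%:R <= m%:R * q%:R by rewrite ler_pM2r.
    have : q%:R * m%:R <= A%:~R * (q%:R * m%:R) :> R by rewrite ler_peMl// ltW.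
    nra.
  have [v ve] := frac_rat R (sgz D * B) n0.
  have vc : ratr c - ratr v = A%:~R / (q%:R * D%:~R) :> R.
    have DN : D%:~R != 0 :> R by rewrite intr_eq0.
    have -> : ratr v = B%:~R / D%:~R :> R.
      rewrite ve nE rmorphM/=; case: (ltrgt0P D) DN0 => // hD _.
        by rewrite gtr0_sgz// mul1r gtr0_norm// ltr0z.
      by rewrite ltr0_sgz// mulN1r ltr0_norm ?ltrz0// invrN mulrNN.
    have -> : A = p * D - q%:Z * B by rewrite -BE; ring.
    rewrite ce rmorphB !rmorphM/=; field.
    by rewrite DN gt_eqF.
  have vNc : v != c.
    apply/eqP => e; move: vc; rewrite e subrr => /esym/eqP.
    by rewrite mulf_eq0 invr_eq0 mulf_eq0 !intr_eq0 (negPf DN0) !gt_eqF.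
  have vD : (den v <= `|D|)%N by apply: dvdn_leq => //; apply: dvdn_den ve.
  have := iso _ vNc (leq_trans vD Dq); rewrite -/q vc.
  have -> : h q = 1 / m%:R by rewrite /hpsi psim; field; rewrite !gt_eqF.
  rewrite normrM normfV normrM (gtr0_norm q0) (@gtr0_norm _ A%:~R) ?ltr0z//.
  have vv : (den v)%:R <= `|D%:~R| :> R by rewrite -nE ler_nat.
  have v0 := denR_gt0 R v.
  move=> hv.
  have {}hv : K * (1 / m%:R) / `|D%:~R| ^+ 2 <= A%:~R / (q%:R * `|D%:~R|).
    apply: le_trans hv; rewrite ler_wpM2l ?mulr_ge0 ?divr_ge0//; try exact: ltW.
    by rewrite lef_pV2 ?posrE ?exprn_gt0// lerXn2r// nnegrE ltW.
  move: hv; move: N0 dA; set N := `|D%:~R| => N0 dA.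
  have -> : K * (1 / m%:R) / N ^+ 2 = K * q%:R / (m%:R * N ^+ 2 * q%:R).
    by field; rewrite !gt_eqF.
  have -> : A%:~R / (q%:R * N) = (A%:~R * m%:R * N) / (m%:R * N ^+ 2 * q%:R).
    by field; rewrite !gt_eqF.
  rewrite ler_pM2r ?invr_gt0 ?mulr_gt0 ?exprn_gt0// => hv.
  have h1 : K * q%:R * q%:R <= A%:~R * m%:R * N * q%:R by rewrite ler_pM2r.
  have h2 : 2 * (A%:~R * q%:R * m%:R) * N <= 3 * d%:R * N by rewrite ler_pM2r.
  have h3 : 0 <= K * q%:R * q%:R by rewrite !mulr_ge0// ltW.
  have : K * q%:R ^+ 2 = K * q%:R * q%:R by rewrite expr2 mulrA.
  have : 2 * (A%:~R * q%:R * m%:R) * N = 2 * (A%:~R * m%:R * N * q%:R) :> R by ring.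
  by rewrite -!mulrA in h1 h2 h3 *; lra.
have psid : psi d <= 1 / (m%:R * d%:R ^+ 2).
  rewrite (psiE _ _ : psi d = h d / d%:R ^+ 2) ?den_gt0//.
  have -> : 1 / (m%:R * d%:R ^+ 2) = 1 / m%:R / d%:R ^+ 2 :> R.
    by field; rewrite !gt_eqF.
  rewrite ler_pM2r ?invr_gt0 ?exprn_gt0//.
  have -> : 1 / m%:R = h q by rewrite /hpsi psim; field; rewrite !gt_eqF.
  by apply: psi_mono; rewrite ?den_gt0// ltnW.
rewrite uy normrM [X in _ <= _ * X]gtr0_norm ?invr_gt0//.
apply: (@le_trans _ _ (K / 2 * (1 / (m%:R * d%:R ^+ 2)))).
  by rewrite ler_pM2l ?divr_gt0.
have -> : K / 2 * (1 / (m%:R * d%:R ^+ 2)) =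
    (K * q%:R ^+ 2 / 2) / (m%:R * d%:R ^+ 2 * q%:R ^+ 2).
  by field; rewrite !gt_eqF.
have -> : `|D%:~R| / (d%:R * q%:R ^+ 2 * m%:R) =
    (d%:R * `|D%:~R|) / (m%:R * d%:R ^+ 2 * q%:R ^+ 2) :> R.
  by field; rewrite !gt_eqF.
by rewrite ler_pM2r// invr_gt0 !mulr_gt0// exprn_gt0.
Qed.

End endpoint.

(** * The total size of the balls that meet a window *)

Section children.
Variables (R : realType) (psi r : nat -> R) (S : R).
Hypothesis psi_gt0 : forall d, (0 < d)%N -> 0 < psi d.
Hypothesis psi_mono : forall d e, (0 < d)%N -> (d <= e)%N ->
  e%:R ^+ 2 * psi e <= d%:R ^+ 2 * psi d.
Hypothesis psi_sum : forall n, \sum_(1 <= q < n) q%:R * psi q <= S.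
Hypothesis psi_div : forall q, (0 < q)%N ->
  exists m : nat, psi q = 1 / (q%:R ^+ 2 * m%:R).
Hypothesis r_gt0 : forall d, (0 < d)%N -> 0 < r d.
Local Notation h := (hpsi psi).

(** [endpoint_sep] then separates by [20 * 64 * psi (den u)]. For [u] within [r q + 4 * psi (den u)]
    of [y] this forces [psi (den u) <= r q / (17 * 64)]. *)
Definition K0 : R := 40 * 64.

(** Such a [u] is within [6 * psi (den c)] of [c], so [rat_sep] gives [6 * den u >= den c * m]. By
    monotonicity of [h], [psi (den u) <= 36 / m ^ 2 * psi (den c)], and [m >= 50] is enough for the
    factor [1 / 64]. *)
Lemma near_endpoint (c u : rat) (z : R) (m : nat) :
  K0 <= m%:R -> psi (den c) = 1 / ((den c)%:R ^+ 2 * m%:R) ->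
  r (den c) <= psi (den c) / 4 -> (den c < den u)%N ->
  ratr c + psi (den c) - r (den c) <= z <= ratr c + psi (den c) ->
  `|z - ratr u| <= 4 * psi (den u) ->
  `|ratr u - (ratr c + psi (den c))| <= r (den c) + 4 * psi (den u) /\
  psi (den u) <= psi (den c) / 64.
Proof.
move=> K0m psim rq qd zJ zu.
have Km : 50 <= m%:R :> R by move: K0m; rewrite /K0; lra.
have m0 : 0 < m%:R :> R by lra.
have q0 := denR_gt0 R c; have d0 := denR_gt0 R u.
have Pq := psi_gt0 (den_gt0 c); have Pd := psi_gt0 (den_gt0 u).
have rq0 := r_gt0 (den_gt0 c).
have Pdq : psi (den u) <= psi (den c) by apply: psi_le => //; rewrite ?den_gt0// ltnW.
split; first by move: zJ zu; rewrite !ler_norml; lra.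
have cu : `|ratr c - ratr u| <= 6 * psi (den c).
  by move: zJ zu; rewrite !ler_norml; lra.
have uc : c != u by apply/eqP => e; move: qd; rewrite e ltnn.
have := le_trans (rat_sep R uc) cu; rewrite psim.
have -> : 6 * (1 / ((den c)%:R ^+ 2 * m%:R)) = 6 / ((den c)%:R ^+ 2 * m%:R) :> R by ring.
rewrite ler_pdivrMr ?mulr_gt0// mulrAC ler_pdivlMr ?mulr_gt0 ?exprn_gt0// => hd.
have {}hd : (den c)%:R * m%:R <= 6 * (den u)%:R :> R.
  have : (den c)%:R * ((den c)%:R * m%:R) <= (den c)%:R * (6 * (den u)%:R) :> R.
    by move: hd; rewrite expr2; lra.
  by rewrite ler_pM2l.
have h1 : psi (den u) * (den u)%:R ^+ 2 <= 1 / m%:R.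
  have -> : 1 / m%:R = (den c)%:R ^+ 2 * psi (den c).
    by rewrite psim; field; rewrite !gt_eqF.
  by rewrite mulrC psi_mono ?den_gt0// ltnW.
have h2 : ((den c)%:R * m%:R) ^+ 2 <= (6 * (den u)%:R) ^+ 2 :> R.
  by rewrite lerXn2r// nnegrE ltW// mulr_gt0.
rewrite ler_pdivlMr// !div1r -(ler_pM2r (exprn_gt0 2 q0)).
have -> : ((den c)%:R ^+ 2 * m%:R)^-1 * (den c)%:R ^+ 2 = 1 / m%:R :> R.
  by field; rewrite !gt_eqF.
have h3 : psi (den u) * (den c)%:R ^+ 2 * m%:R ^+ 2 <= 36 * (1 / m%:R).
  apply: (@le_trans _ _ (psi (den u) * (6 * (den u)%:R) ^+ 2)).
    by rewrite -mulrA -exprMn ler_pM2l.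
  by rewrite exprMn; lra.
have h4 : 64 * 36 <= m%:R ^+ 2 :> R.
  apply: (@le_trans _ _ (50 * 50)); first lra.
  by rewrite expr2 ler_pM.
have h5 : psi (den u) * (den c)%:R ^+ 2 * (64 * 36) <=
    psi (den u) * (den c)%:R ^+ 2 * m%:R ^+ 2.
  by rewrite ler_pM2l// mulr_gt0// exprn_gt0.
lra.
Qed.

Lemma hpsi_inv (q m : nat) : (0 < q)%N -> psi q = 1 / (q%:R ^+ 2 * m%:R) ->
  h q = 1 / m%:R /\ 0 < m%:R :> R.
Proof.
move=> q0 e; have Pq := psi_gt0 q0.
have q1 : 0 < q%:R :> R by rewrite ltr0n.
have m0 : 0 < m%:R :> R.
  by rewrite lt0r ler0n andbT; apply/eqP => m0; move: Pq; rewrite e m0 mulr0 invr0 mulr0 ltxx.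
by split => //; rewrite /hpsi e; field; rewrite !gt_eqF.
Qed.

(** Three groups: [y] alone, controlled by the hypothesis on [omega]; denominators below [2 ^ j0],
    few and each with a small ball by [endpoint_sep]; and larger ones, where the count is
    proportional to length and the dyadic tail applies. They contribute at most [8 / 100], [1 / 8]
    and [1 / 8] of [lam]. *)
Lemma bad_sum_at (q j1 : nat) (c : rat) :
  (forall n, \sum_(j1 <= j < n) h (2 ^ j) <= 1 / (17 * 64)) -> (2 ^ j1.+1 <= q)%N ->
  r q <= psi q / 4 -> (forall N : nat, psi q * N%:R = 1 -> 100 * psi N <= r q) ->
  h q <= 1 / K0 -> den c = q -> isolated_rat psi K0 c ->
  forall s, uniq s ->
    {in s, forall u, (q < den u)%N /\ exists2 z,
      ratr c + psi q - r q <= z <= ratr c + psi q & `|z - ratr u| <= 4 * psi (den u)} ->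
    \sum_(u <- s) 8 * psi (den u) <= 3 / 8 * r q.
Proof.
move=> hj1 q1 rq rge hq cq iso s us sP.
have qgt0 : (0 < q)%N by rewrite -cq den_gt0.
have q0 : 0 < q%:R :> R by rewrite ltr0n.
have [m psim] := psi_div qgt0.
have [hm m0] := hpsi_inv qgt0 psim.
have Km : K0 <= m%:R.
  by move: hq; rewrite hm !div1r lef_pV2// posrE /K0.
have K00 : 0 < K0 by rewrite /K0.
set lam := r q in rq rge *; have lam0 : 0 < lam by exact: r_gt0.
set y := ratr c + psi q.
have Pd u : 0 < psi (den u) by exact/psi_gt0/den_gt0.
have sP2 u : u \in s -> [/\ (q < den u)%N, `|ratr u - y| <= lam + 4 * psi (den u) &
    (ratr u = y /\ psi (den u) <= lam / 100) \/ 20 * 64 * psi (den u) <= `|ratr u - y|].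
  move=> /sP[qd [z zJ zu]].
  have [n1 n2] : `|ratr u - y| <= lam + 4 * psi (den u) /\ psi (den u) <= psi q / 64.
    by have := @near_endpoint c u z m; rewrite cq; exact.
  split => //.
  have := @endpoint_sep R psi psi_mono K0 c u m K00 Km.
  rewrite cq => /(_ psim iso qd) [|[-> Nd]|].
  - by apply: le_trans n1 _; lra.
  - left; split => //.
    have := rge (q ^ 2 * m)%N; rewrite natrM natrX psim => /(_ _)/le_trans h1.
    have mN0 : (0 < m)%N by rewrite -(ltr_nat R).
    have : psi (den u) <= psi (q ^ 2 * m).
      by apply: psi_le => //; rewrite muln_gt0 expn_gt0 qgt0.
    have : 100 * psi (q ^ 2 * m) <= lam.
      by apply: rge; rewrite psim natrM natrX divfK// gt_eqF// mulr_gt0// exprn_gt0.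
    lra.
  - by rewrite /K0 => h1; right; lra.
(* [j0] is the first scale at which [1 / 4 ^ j0] drops to [lam] or less. Below it, an interval of
   length [4 * lam] has at most [1 + 16 = 17] rationals. It comes after [j1] because
   [lam <= 1 / q ^ 2 < 1 / 4 ^ j1]. *)
have [j0 [j10 hj0 hj0']] : exists j0, [/\ (j1 <= j0)%N, 1 <= lam * 4 ^+ j0 & lam * 4 ^+ j0 <= 4].
  have [j1' hj1'] : exists j, 1 <= lam * 4 ^+ j.
    have [n0 _ hn0] := exp2V_small lam0.
    exists n0; have := hn0 _ (leqnn n0); rewrite ler_pdivrMr ?exprn_gt0//= => /le_trans; apply.
    rewrite ler_pM2l// exp4E expr2 ler_peMl ?exprn_ege1// ?exprn_ge0//; lra.
  case: (@ex_minnP (fun j => 1 <= lam * 4 ^+ j)); first by exists j1'.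
  move=> j0 hj0 minj0; exists j0.
  have lt1 : lam * 4 ^+ j1 < 1.
    have lamq : lam <= 1 / q%:R ^+ 2.
      apply: (@le_trans _ _ (psi q)); first by have := psi_gt0 qgt0; lra.
      rewrite psim !div1r lef_pV2 ?posrE ?mulr_gt0 ?exprn_gt0// ler_peMr ?exprn_ge0//.
      by move: Km; rewrite /K0; lra.
    apply: (@le_lt_trans _ _ (1 / q%:R ^+ 2 * 4 ^+ j1)).
      by rewrite ler_pM2r// exprn_gt0.
    rewrite mulrC mulrA mulr1 ltr_pdivrMr ?exprn_gt0// mul1r exp4E.
    rewrite ltrXn2r// ?nnegrE ?exprn_ge0// ?ltW//.
    by rewrite -natrX ltr_nat (leq_trans _ q1)// ltn_exp2l.
  have j10 : (j1 < j0)%N.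
    rewrite ltnNge; apply/negP => j01; move: lt1; apply/negP; rewrite -leNgt.
    by apply: le_trans hj0 _; rewrite ler_pM2l// ler_weXn2l//; lra.
  split => //; first exact: ltnW.
  case: j0 hj0 minj0 j10 => // j0 hj0 minj0 _.
  rewrite exprS mulrCA; have : lam * 4 ^+ j0 <= 1.
    by rewrite leNgt; apply/negP => /ltW/minj0; rewrite ltnn.
  lra.
rewrite (bigID (fun u => ratr u == y))/=.
have S1 : \sum_(u <- s | ratr u == y) 8 * psi (den u) <= 8 / 100 * lam.
  rewrite -big_filter; set t := [seq _ <- s | _].
  have : uniq t by exact: filter_uniq.
  have tP u : u \in t -> u \in s /\ ratr u = y.
    by rewrite mem_filter => /andP[/eqP].
  case: t tP => [|u [|v t]] tP; first by rewrite big_nil => _; lra.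
    rewrite big_seq1 => _; have [us' uy] := tP _ (mem_head _ _).
    have [_ _ [[_]|]] := sP2 _ us'; first lra.
    by rewrite uy subrr normr0; have := Pd u; lra.
  have [_ uy] := tP u (mem_head _ _).
  have [_ vy] : v \in s /\ ratr v = y by apply: tP; rewrite !in_cons eqxx orbT.
  have : ratr u == ratr v :> R by rewrite uy vy.
  by rewrite fmorph_eq => /eqP ->; rewrite /= in_cons eqxx.
apply: (@le_trans _ _ (8 / 100 * lam + (lam / 8 + lam / 8))); last lra.
apply: lerD S1 _; rewrite -big_filter; set t := [seq _ <- s | _].
have ut : uniq t by exact: filter_uniq.
have tP u : u \in t -> [/\ (q < den u)%N, y - 2 * lam <= ratr u <= y - 2 * lam + 4 * lam &
    psi (den u) <= lam / (17 * 64)].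
  rewrite mem_filter => /andP[uNy /sP2[h1 h2 [[/eqP]|h3]]]; first by rewrite (negPf uNy).
  have h4 : psi (den u) <= lam / (17 * 64) by lra.
  by split => //; move: h2; rewrite ler_norml; lra.
rewrite (bigID (fun u => (den u < 2 ^ j0)%N))/=.
have S2 : \sum_(u <- t | (den u < 2 ^ j0)%N) 8 * psi (den u) <= lam / 8.
  rewrite -big_filter; set t1 := [seq _ <- t | _].
  apply: (@le_trans _ _ (\sum_(u <- t1) 8 / (17 * 64) * lam)).
    rewrite big_seq [leRHS]big_seq; apply: ler_sum => u.
    by rewrite mem_filter => /andP[_ /tP[_ _]]; lra.
  rewrite big_const_seq count_predT iter_addr_0 -[leLHS]mulr_natl.
  have : (size t1)%:R <= 1 + 4 * lam * (2 ^ j0)%:R ^+ 2.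
    apply: (@size_rats R t1 _ (y - 2 * lam)); rewrite ?expn_gt0 ?filter_uniq//; first lra.
    by move=> u; rewrite mem_filter => /andP[h1 /tP[_ h2 _]]; split => //; exact: ltnW.
  rewrite natrX -exp4E -mulrA => hs.
  have {hs} : (size t1)%:R <= 17 :> R by lra.
  nra.
have S3 : \sum_(u <- t | ~~ (den u < 2 ^ j0)%N) 8 * psi (den u) <= lam / 8.
  rewrite -big_filter; set t1 := [seq _ <- t | _].
  pose k := (\max_(u <- t1) den u)%N.
  have F0 j : 0 <= 8 * (h (2 ^ j) / 4 ^+ j).
    by rewrite mulr_ge0// divr_ge0 ?exprn_ge0// (hpsi_ge0 psi_gt0).
  apply: le_trans (@sum_dyadic_blocks R _ _ (y - 2 * lam) (4 * lam) j0 k t1 _ F0 _ _ _) _.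
  - lra.
  - move=> u j h1 _; rewrite ler_pM2l// (psiE _ (den_gt0 u)).
    rewrite exp4E ler_pM ?invr_ge0 ?exprn_ge0 ?(hpsi_ge0 psi_gt0)//.
      by apply: psi_mono; rewrite ?expn_gt0.
    rewrite lef_pV2 ?posrE ?exprn_gt0 ?denR_gt0//.
    by rewrite lerXn2r ?nnegrE ?exprn_ge0// -natrX ler_nat.
  - exact: filter_uniq.
  - move=> u ut1; move: (ut1); rewrite mem_filter -leqNgt => /andP[h1 /tP[_ h2 _]].
    split => //; apply: (@leq_ltn_trans k).
      by rewrite /k; exact: (@leq_bigmax_seq _ t1 xpredT den u).
    by apply: leq_ltn_trans (leq_addl j0 k) _; rewrite ltn_expl.
  (* Since [lam * 4 ^ j >= 1] from [j0] on, the count [1 + 16 * lam * 4 ^ j] is at most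
     [17 * lam * 4 ^ j]. *)
  apply: (@le_trans _ _ (\sum_(j0 <= j < j0 + k) 17 * 8 * lam * h (2 ^ j))).
    apply: ler_sum_nat => j /andP[j0j _].
    have p4 : 0 < 4 ^+ j :> R by rewrite exprn_gt0.
    have h1 : 1 <= lam * 4 ^+ j.
      by apply: le_trans hj0 _; rewrite ler_pM2l// ler_weXn2l//; lra.
    have H0 : 0 <= h (2 ^ j) by exact: hpsi_ge0.
    apply: (@le_trans _ _ ((17 * lam * 4 ^+ j) * (8 * (h (2 ^ j) / 4 ^+ j)))).
      by rewrite ler_wpM2r//; lra.
    rewrite le_eqVlt; apply/orP; left; apply/eqP; field.
    by rewrite gt_eqF.
  rewrite -mulr_sumr.
  have : \sum_(j0 <= j < j0 + k) h (2 ^ j) <= 1 / (17 * 64).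
    apply: le_trans (hj1 (j0 + k)%N).
    have [?|jk] := leqP (j0 + k) j0.
      by rewrite big_geq// sumr_ge0// => i _; exact: hpsi_ge0.
    rewrite (@big_cat_nat _ _ _ j0 j1 (j0 + k))//= ?leq_addr//.
    by rewrite lerDr sumr_ge0// => i _; exact: hpsi_ge0.
  set X := \sum_(_ <= j < _) _ => hX.
  have : 17 * 8 * lam * X <= 17 * 8 * lam * (1 / (17 * 64)) by rewrite ler_wpM2l//; lra.
  lra.
exact: lerD S2 S3.
Qed.

Hypothesis r_le : \forall q \near \oo, r q <= psi q / 4.
Hypothesis r_ge : \forall q \near \oo, forall N : nat,
  psi q * N%:R = 1 -> 100 * psi N <= r q.

Lemma bad_sum : \forall q \near \oo, forall c, den c = q -> isolated_rat psi K0 c ->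
  forall s, uniq s ->
    {in s, forall u, (q < den u)%N /\ exists2 z,
      ratr c + psi q - r q <= z <= ratr c + psi q & `|z - ratr u| <= 4 * psi (den u)} ->
    \sum_(u <- s) 8 * psi (den u) <= 3 / 8 * r q.
Proof.
have e0 : 0 < 1 / (17 * 64) :> R by rewrite divr_gt0// mulr_gt0.
have [j1 hj1] := dyadic_tail psi_gt0 psi_mono psi_sum e0.
near=> q => c; apply: (bad_sum_at hj1).
- by near: q; exact: nbhs_infty_ge.
- by near: q; exact: r_le.
- by near: q; exact: r_ge.
- near: q; apply: (hpsi_small psi_gt0 psi_mono psi_sum).
  by rewrite divr_gt0// mulr_gt0.
Unshelve. all: by end_near. Qed.

End children.

Lemma sub_eighths_lt (R : realType) (y l : R) : 0 < l -> y - 7 / 8 * l < y - l / 8.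
Proof. lra. Qed.

(** * Many children in each window *)

Section branching.
Variables (R : realType) (psi r : nat -> R) (S : R).
Hypothesis psi_gt0 : forall d, (0 < d)%N -> 0 < psi d.
Hypothesis psi_mono : forall d e, (0 < d)%N -> (d <= e)%N ->
  e%:R ^+ 2 * psi e <= d%:R ^+ 2 * psi d.
Hypothesis psi_sum : forall n, \sum_(1 <= q < n) q%:R * psi q <= S.
Hypothesis psi_div : forall q, (0 < q)%N ->
  exists m : nat, psi q = 1 / (q%:R ^+ 2 * m%:R).
Hypothesis r_gt0 : forall d, (0 < d)%N -> 0 < r d.
Local Notation h := (hpsi psi).
Local Notation K0 := (K0 R).

(** The last clause covers only denominators between those of [c] and [c']; along a chain of
    children these ranges exhaust all denominators above the first. The factor 2 leaves room for a
    limit point that is [psi (den c')] away from [c']. *)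
Definition child (c c' : rat) := [/\ (den c < den c')%N, isolated_rat psi K0 c',
  ratr c + psi (den c) - r (den c) <= ratr c',
  ratr c' + psi (den c') <= ratr c + psi (den c) &
  forall u, (den c < den u <= den c')%N -> u != c' ->
    2 * psi (den u) <= `|ratr c' - ratr u|].

(** The middle part of the window has length [3 / 4 * lam], of which the balls take at most half.
    Margins of [lam / 16] remain at both ends, the right one to accommodate
    [psi (den c') <= lam / 16]. The bound [1 / 2 ^ 21] on [h] is matched to
    [4 ^ J <= 2 ^ 20 * den c' ^ 2]; it makes [psi (den c')] smaller than the spacing of the
    children. *)
Lemma many_children_at (q J : nat) (c : rat) (y lam : R) :
  den c = q -> y = ratr c + psi q -> lam = r q ->
  (forall s, uniq s ->
    {in s, forall u, (q < den u)%N /\ exists2 z,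
      ratr c + psi q - r q <= z <= ratr c + psi q & `|z - ratr u| <= 4 * psi (den u)} ->
    \sum_(u <- s) 8 * psi (den u) <= 3 / 8 * r q) ->
  (10 <= J)%N -> (q + 10 < J)%N ->
  h (2 ^ (J - 10)) <= lam / 16 -> h (2 ^ (J - 10)) <= 1 / 2 ^+ 21 ->
  (forall bad : seq rat,
    \sum_(u <- bad) 8 * psi (den u) <= (y - lam / 8 - (y - 7 / 8 * lam)) / 2 ->
    exists s, [/\ uniq s,
      (y - lam / 8 - (y - 7 / 8 * lam)) * 4 ^+ J <= 2 ^+ 13 * (size s)%:R &
      forall c, c \in s -> [/\ (2 ^ (J - 10) <= den c <= 2 ^ J)%N,
        y - 7 / 8 * lam - lam / 16 <= ratr c <= y - lam / 8 + lam / 16, isolated_rat psi K0 c &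
        forall u, u \in bad -> u != c -> (den u <= den c)%N ->
          2 * psi (den u) <= `|ratr c - ratr u|]]) ->
  exists s, [/\ uniq s, lam * 4 ^+ J <= 2 ^+ 14 * (size s)%:R &
    forall c', c' \in s -> [/\ (den c' <= 2 ^ J)%N, child c c' &
      2 * 4 ^+ J * psi (den c') <= 1]].
Proof.
move=> cq ye lame bad J10 Jq hJ1 hJ2 key.
have q0 : (0 < q)%N by rewrite -cq den_gt0.
have lam0 : 0 < lam by rewrite lame r_gt0.
rewrite -lame -ye in bad.
have H0 : 0 <= h (2 ^ (J - 10)) by exact: hpsi_ge0.
pose B := lam + 4 * psi 1.
have [l ul lP] := rats_between (2 ^ J) (y - B) (y + B).
pose P u := (q < den u)%N /\ exists2 z, y - lam <= z <= y & `|z - ratr u| <= 4 * psi (den u).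
pose bl := [seq u <- l | `[< P u >]].
have blP u : u \in bl -> P u by rewrite mem_filter => /andP[/asboolP].
have [|s [us ss sP]] := key bl.
  by have := bad bl (filter_uniq _ ul) blP; lra.
exists s; split => //.
  have p4 : 0 <= lam * 4 ^+ J by rewrite mulr_ge0 ?exprn_ge0// ltW.
  have : 2 ^+ 13 * (size s)%:R * 2 = 2 ^+ 14 * (size s)%:R :> R.
    by rewrite (exprS 2 13); ring.
  lra.
move=> c' c's; have [/andP[d1 d2] /andP[r1 r2] iso' av] := sP _ c's.
have hd : h (den c') <= h (2 ^ (J - 10)) by apply: psi_mono; rewrite ?expn_gt0.
have psih : psi (den c') = h (den c') / (den c')%:R ^+ 2 by rewrite psiE ?den_gt0.
have d0 := denR_gt0 R c'.
have psic' : psi (den c') <= lam / 16.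
  apply: le_trans hJ1; apply: le_trans hd.
  by rewrite psih ler_pdivrMr ?exprn_gt0// ler_peMr ?hpsi_ge0// exprn_ege1// den_ge1.
split => //; last first.
  have E : 4 ^+ J <= 2 ^+ 20 * (den c')%:R ^+ 2 :> R.
    rewrite exp4E -[20%N]/(10 * 2)%N exprM -exprMn lerXn2r ?nnegrE ?mulr_ge0 ?exprn_ge0//.
    by rewrite -!natrX -natrM ler_nat -(subnK J10) expnD mulnC leq_mul2l d1 orbT.
  rewrite psih mulrA ler_pdivrMr ?exprn_gt0// mul1r.
  have : h (den c') <= 1 / 2 ^+ 21 by apply: le_trans hJ2.
  rewrite ler_pdivlMr ?exprn_gt0// => hh.
  have hh0 : 0 <= h (den c') by exact: hpsi_ge0.
  apply: (@le_trans _ _ (2 * (2 ^+ 20 * (den c')%:R ^+ 2) * h (den c'))).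
    by rewrite ler_wpM2r// ler_pM2l.
  have -> : 2 * (2 ^+ 20 * (den c')%:R ^+ 2) * h (den c') =
      (h (den c') * 2 ^+ 21) * (den c')%:R ^+ 2 :> R by rewrite (exprS 2 20); ring.
  by rewrite ler_piMl// exprn_ge0.
rewrite /child cq -lame -ye; split => //.
- apply: (leq_trans _ d1); apply: (leq_trans (ltn_expl q (isT : (1 < 2)%N))).
  by rewrite leq_exp2l// leq_subRL// addnC ltnW.
- lra.
- lra.
(* A [u] closer than [2 * psi (den u)] to [c'] has a ball meeting the window at [c'], so it is in
   [bl] after all. *)
- move=> u /andP[u1 u2] uc'.
  have Pu : 0 < psi (den u) by rewrite psi_gt0// den_gt0.
  have [ub|unb] := boolP (u \in bl); first exact: av.
  rewrite leNgt; apply/negP => lt; move: unb; apply/negP; rewrite negbK.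
  rewrite mem_filter lP (leq_trans u2 d2)/=; apply/andP; split.
    apply/asboolP; split => //; exists (ratr c'); first by lra.
    by lra.
  have : psi (den u) <= psi 1 by apply: psi_le => //; exact: den_gt0.
  by move: lt; rewrite /B ltr_norml; lra.
Qed.

Hypothesis r_le : \forall q \near \oo, r q <= psi q / 4.
Hypothesis r_ge : \forall q \near \oo, forall N : nat,
  psi q * N%:R = 1 -> 100 * psi N <= r q.

Lemma many_children : \forall q \near \oo, forall c, den c = q -> isolated_rat psi K0 c ->
  \forall J \near \oo, exists s, [/\ uniq s, r q * 4 ^+ J <= 2 ^+ 14 * (size s)%:R &
    forall c', c' \in s -> [/\ (den c' <= 2 ^ J)%N, child c c' &
      2 * 4 ^+ J * psi (den c') <= 1]].
Proof.
near=> q => c cq iso.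
have bad : forall c, den c = q -> isolated_rat psi K0 c -> forall s, uniq s ->
    {in s, forall u, (q < den u)%N /\ exists2 z,
      ratr c + psi q - r q <= z <= ratr c + psi q & `|z - ratr u| <= 4 * psi (den u)} ->
    \sum_(u <- s) 8 * psi (den u) <= 3 / 8 * r q.
  by near: q; exact: (bad_sum psi_gt0 psi_mono psi_sum psi_div r_gt0 r_le r_ge).
have q0 : (0 < q)%N by rewrite -cq den_gt0.
have lam0 := r_gt0 q0.
set y := ratr c + psi q.
have ab : y - 7 / 8 * r q < y - r q / 8 by exact: sub_eighths_lt.
have e0 : 0 < r q / 16 by rewrite divr_gt0.
have K00 : 0 < K0 by rewrite mulr_gt0.
have m0 : 0 < Num.min (r q / 16) (1 / 2 ^+ 21) by rewrite lt_min e0 divr_gt0// exprn_gt0.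
near=> J.
have J10 : (10 <= J)%N by near: J; exact: nbhs_infty_ge.
have hJ : J%:R * h (2 ^ (J - 10)) <= Num.min (r q / 16) (1 / 2 ^+ 21).
  by near: J; exact: (mul_hpsi_shift psi_gt0 psi_mono psi_sum).
have /andP[hJ1 hJ2] : (h (2 ^ (J - 10)) <= r q / 16) && (h (2 ^ (J - 10)) <= 1 / 2 ^+ 21).
  rewrite -le_min; apply: le_trans hJ.
  by rewrite ler_peMl ?hpsi_ge0// ler1n (leq_trans _ J10).
have key : forall bad : seq rat,
    \sum_(u <- bad) 8 * psi (den u) <= (y - r q / 8 - (y - 7 / 8 * r q)) / 2 ->
    exists s, [/\ uniq s,
      (y - r q / 8 - (y - 7 / 8 * r q)) * 4 ^+ J <= 2 ^+ 13 * (size s)%:R &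
      forall c, c \in s -> [/\ (2 ^ (J - 10) <= den c <= 2 ^ J)%N,
        y - 7 / 8 * r q - r q / 16 <= ratr c <= y - r q / 8 + r q / 16, isolated_rat psi K0 c &
        forall u, u \in bad -> u != c -> (den u <= den c)%N ->
          2 * psi (den u) <= `|ratr c - ratr u|]].
  by near: J; exact: (isolated_rats psi_gt0 psi_mono psi_sum K00 ab e0).
apply: (@many_children_at q J c y (r q)) => //.
- exact: bad.
- by near: J; exact: nbhs_infty_gt.
Unshelve. all: by end_near. Qed.

End branching.

(** * Averaging over the children against a cover *)

Section selection.
Variables (R : realType) (psi r : nat -> R).
Hypothesis psi_gt0 : forall d, (0 < d)%N -> 0 < psi d.
Hypothesis r_gt0 : forall d, (0 < d)%N -> 0 < r d.
Hypothesis r_lt : forall d, (0 < d)%N -> r d < psi d.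
Hypothesis r_mono : forall d e, (0 < d)%N -> (d <= e)%N -> r e <= r d.
Variables (t : R) (U : nat -> set R) (d : nat -> R).
Hypothesis t_gt0 : 0 < t.
Hypothesis t_le1 : t <= 1.
Hypothesis d_gt0 : forall i, 0 < d i.
Hypothesis U_diam : forall i x y, U i x -> U i y -> `|x - y| <= d i.

Definition window (c : rat) (x : R) :=
  ratr c + psi (den c) - r (den c) <= x <= ratr c + psi (den c).

Definition window_meets i (c : rat) : bool := `[< exists2 x, U i x & window c x >].

(** With this value [2 * 4 ^ J * (beta * lam)] is half of [lam * 4 ^ J / 2 ^ 14], the lower bound
    for the number of children. *)
Definition beta : R := 1 / (4 * 2 ^+ 14).

Lemma beta_gt0 : 0 < beta.
Proof. by rewrite divr_gt0// mulr_gt0// exprn_gt0. Qed.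

Definition sparse (c : rat) := forall n,
  \sum_(0 <= i < n | window_meets i c) d i `^ t <= (beta * r (den c)) `^ t.

Lemma child_window c c' x : child psi r c c' -> window c' x -> window c x.
Proof.
move=> [_ _ h1 h2 _] /andP[h3 h4]; have := r_lt (den_gt0 c').
by move=> h5; apply/andP; split; lra.
Qed.

Lemma sparse_term c i : sparse c -> window_meets i c -> d i `^ t <= (beta * r (den c)) `^ t.
Proof.
move=> /(_ i.+1) + mi; apply: le_trans.
by rewrite big_mkcond big_nat_recr//= mi lerDr sumr_ge0// => j _; case: ifP => // _; exact: powR_ge0.
Qed.

(** Each [d i] in the sum is at most [beta * r (den c)], so its ratio to this bound does not exceed
    the [t]-th power of the ratio, as [t <= 1]. *)
Lemma sparse_diam c n : sparse c ->
  \sum_(0 <= i < n | window_meets i c) d i <= beta * r (den c).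
Proof.
move=> sc; set bl := beta * r (den c).
have bl0 : 0 < bl by rewrite mulr_gt0 ?beta_gt0// r_gt0// den_gt0.
have blt0 : 0 < bl `^ t by exact: powR_gt0.
have le1 i : window_meets i c -> d i <= bl * (d i `^ t / bl `^ t).
  move=> mi; rewrite mulrC -ler_pdivrMr//.
  have db : d i <= bl.
    rewrite leNgt; apply/negP => lt; have := sparse_term sc mi; apply/negP; rewrite -ltNge.
    by apply: gt0_ltr_powR; rewrite // nnegrE ltW.
  have E : d i `^ t = (d i / bl) `^ t * bl `^ t.
    by rewrite -powRM ?divfK ?gt_eqF// ?divr_ge0// ltW.
  rewrite E mulfK ?gt_eqF//; apply: ger1_powR => //.
  by rewrite divr_gt0//= ler_pdivrMr// mul1r.
apply: (@le_trans _ _ (\sum_(0 <= i < n | window_meets i c) bl * (d i `^ t / bl `^ t))).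
  exact: ler_sum.
have bl0' := ltW bl0.
rewrite -mulr_sumr -mulr_suml ler_piMr// ler_pdivrMr// mul1r; exact: sc.
Qed.

(** The windows start and end within [psi (den c') <= 1 / (2 * 4 ^ J)] of their [c'], so these [c']
    fill an interval of length [2 * d i + 1 / (2 * 4 ^ J)]; [size_rats] gives
    [3 / 2 + 2 * 4 ^ J * d i]. *)
Lemma size_meets c J (s : seq rat) i : uniq s ->
  {in s, forall c', [/\ (den c' <= 2 ^ J)%N, child psi r c c' & 2 * 4 ^+ J * psi (den c') <= 1]} ->
  (size [seq c' <- s | window_meets i c'])%:R <= 2 + 2 * 4 ^+ J * d i.
Proof.
move=> us sP; set l := [seq _ <- s | _].
have lP c' : c' \in l -> [/\ (den c' <= 2 ^ J)%N, 2 * 4 ^+ J * psi (den c') <= 1 &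
    exists2 x, U i x & window c' x].
  by rewrite mem_filter => /andP[/asboolP ? /sP[? _ ?]].
have p4 : 0 < 4 ^+ J :> R by rewrite exprn_gt0.
have di0 := d_gt0 i.
have : uniq l by exact: filter_uniq.
case: l lP => [|c0 l] lP ul.
  by apply: addr_ge0 => //; rewrite !mulr_ge0// ltW.
have [_ _ [x0 Ux0 _]] := lP c0 (mem_head _ _).
have q0 : 0 < 1 / (2 * 4 ^+ J) :> R by rewrite divr_gt0// mulr_gt0.
have := @size_rats R (c0 :: l) (2 ^ J) (x0 - d i - 1 / (2 * 4 ^+ J)) (2 * d i + 1 / (2 * 4 ^+ J)).
rewrite natrX -exp4E => h; apply: le_trans (h _ _ _ _) _ => //.
- by apply: addr_ge0; [rewrite mulr_ge0// ltW | exact: ltW].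
- by rewrite expn_gt0.
- move=> c' /lP[c'J psic' [x Ux /andP[x1 x2]]]; split => //.
  have psih : psi (den c') <= 1 / (2 * 4 ^+ J).
    by rewrite ler_pdivlMr ?mulr_gt0// mulrC.
  have := U_diam Ux0 Ux; have := r_lt (den_gt0 c').
  by move: x1 x2 psih; rewrite ler_norml; lra.
- have -> : (2 * d i + 1 / (2 * 4 ^+ J)) * 4 ^+ J = 2 * 4 ^+ J * d i + 1 / 2.
    by field; rewrite gt_eqF.
  lra.
Qed.

(** If no child is sparse, the [U i] meeting its window have total weight [w] at least 1 for every
    child. Double counting with [size_meets] bounds the number of children by the sum of
    [2 * w i + 2 * 4 ^ J * d i] over the [U i] meeting the window of [c]. The two parts are at most
    1/4 and 1/2 of the lower bound for that number. *)
Lemma select_child c J (s : seq rat) : uniq s -> sparse c ->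
  r (den c) * 4 ^+ J <= 2 ^+ 14 * (size s)%:R ->
  8 * 2 ^+ 14 * r (den c) `^ t <= r (den c) * 4 ^+ J * r (2 ^ J) `^ t ->
  {in s, forall c', [/\ (den c' <= 2 ^ J)%N, child psi r c c' & 2 * 4 ^+ J * psi (den c') <= 1]} ->
  exists2 c', c' \in s & sparse c'.
Proof.
move=> us sc ssz big sP; apply: contrapT => no.
have lam0 := r_gt0 (den_gt0 c); set lam := r (den c) in ssz big lam0 *.
have J0 : (0 < 2 ^ J)%N by rewrite expn_gt0.
have rJ0 := r_gt0 J0; set rJ := r (2 ^ J) in big rJ0 *.
have b0 := beta_gt0.
have bJ0 : 0 < (beta * rJ) `^ t by rewrite powR_gt0// mulr_gt0.
have rJt0 : 0 < rJ `^ t by exact: powR_gt0.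
have /choice[f fP] : forall c', exists n, c' \in s ->
    (beta * r (den c')) `^ t < \sum_(0 <= i < n | window_meets i c') d i `^ t.
  move=> c'; have [c's|] := boolP (c' \in s); last by exists 0%N.
  have : ~ sparse c' by move=> sc'; apply: no; exists c'.
  by move=> /existsNP[n /negP]; rewrite -ltNge => ?; exists n.
(* Failure of sparsity shows in a finite partial sum, so one [n] serves all children. *)
pose n := (\max_(c' <- s) f c')%N.
(* The cap at 1 keeps [4 ^ J * d i * w i] below [4 ^ J * d i] for large sets; a single capped set
   already gives a child weight 1. *)
pose w i : R := Num.min 1 (d i `^ t / (beta * rJ) `^ t).
have w0 i : 0 <= w i by rewrite le_min ler01 divr_ge0// powR_ge0.
have w1 i : w i <= 1 by rewrite ge_min lexx.
have W c' : c' \in s -> 1 <= \sum_(0 <= i < n | window_meets i c') w i.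
  move=> c's; have [c'J _ _] := sP _ c's.
  have [[i [im inn iw]]|nw] := pselect (exists i, [/\ window_meets i c', (i < n)%N & w i = 1]).
    rewrite (big_cat_nat (leq0n i) (ltnW inn))/= (big_ltn_cond inn)/= im iw.
    by rewrite addrCA lerDl addr_ge0// sumr_ge0.
  have : \sum_(0 <= i < n | window_meets i c') d i `^ t / (beta * rJ) `^ t <=
         \sum_(0 <= i < n | window_meets i c') w i.
    rewrite big_nat_cond [leRHS]big_nat_cond; apply: ler_sum => i /andP[/andP[_ inn] im].
    rewrite /w le_min lexx andbT leNgt; apply/negP => lt; apply: nw; exists i; split => //.
    by rewrite /w; apply/min_idPl; exact: ltW.
  apply: le_trans; rewrite -mulr_suml ler_pdivlMr// mul1r ltW//.
  apply: (@le_lt_trans _ _ ((beta * r (den c')) `^ t)).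
    have bj : beta * rJ <= beta * r (den c').
      by rewrite ler_pM2l//; apply: r_mono => //; exact: den_gt0.
    apply: ge0_ler_powR => //; rewrite ?nnegrE; try exact: ltW.
    - by rewrite mulr_ge0// ltW.
    - by rewrite mulr_ge0 ?ltW// r_gt0// den_gt0.
  apply: lt_le_trans (fP c' c's) _.
  have fn : (f c' <= n)%N by exact: (@leq_bigmax_seq _ s xpredT f c').
  rewrite [leRHS](big_cat_nat (leq0n (f c')) fn)/= lerDl sumr_ge0// => i _.
  exact: powR_ge0.
have T1 : (size s)%:R <= \sum_(c' <- s) \sum_(0 <= i < n | window_meets i c') w i.
  rewrite -sum1_size natr_sum big_seq [leRHS]big_seq; apply: ler_sum => c' c's.
  exact: W.
have T2 : \sum_(c' <- s) \sum_(0 <= i < n | window_meets i c') w i <=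
    \sum_(0 <= i < n | window_meets i c) (2 * w i + 2 * 4 ^+ J * d i).
  under eq_bigr do rewrite big_mkcond/=.
  rewrite exchange_big/= [leRHS]big_mkcond/=; apply: ler_sum => i _.
  rewrite -big_mkcond/= -big_filter big_const_seq count_predT iter_addr_0 -[leLHS]mulr_natl.
  case: ifPn => mi.
    have := size_meets i us sP; set X := (size _)%:R => hX.
    apply: (@le_trans _ _ ((2 + 2 * 4 ^+ J * d i) * w i)); first by rewrite ler_wpM2r.
    rewrite mulrDl lerD2l ler_piMr// !mulr_ge0 ?exprn_ge0//; exact: ltW.
  suff -> : [seq c' <- s | window_meets i c'] = [::] by rewrite mul0r.
  apply/eqP; rewrite -[_ == _]negbK -has_filter; apply/hasPn => c' c's.
  apply: contra mi => /asboolP[x Ux wx]; apply/asboolP; exists x => //.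
  by have [_ cc' _] := sP _ c's; exact: child_window cc' wx.
have T3 : \sum_(0 <= i < n | window_meets i c) (2 * w i + 2 * 4 ^+ J * d i) <=
    2 * (lam `^ t / rJ `^ t) + 2 * 4 ^+ J * (beta * lam).
  rewrite big_split/= -!mulr_sumr; apply: lerD.
    rewrite ler_pM2l//.
    apply: (@le_trans _ _ (\sum_(0 <= i < n | window_meets i c) d i `^ t / (beta * rJ) `^ t)).
      by apply: ler_sum => i _; rewrite /w ge_min lexx orbT.
    rewrite -mulr_suml ler_pdivrMr//; apply: le_trans (sc n) _.
    rewrite -/lam !powRM; try exact: ltW.
    rewrite le_eqVlt; apply/orP; left; apply/eqP; field.
    by rewrite gt_eqF.
  by rewrite ler_pM2l ?mulr_gt0 ?exprn_gt0//; exact: sparse_diam.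
have T4 : 2 * (lam `^ t / rJ `^ t) <= lam * 4 ^+ J / (4 * 2 ^+ 14).
  rewrite mulrA ler_pdivrMr// mulrAC ler_pdivlMr ?mulr_gt0 ?exprn_gt0//.
  by move: big; set P := 2 ^+ 14; lra.
have p14 : 0 < 2 ^+ 14 :> R by rewrite exprn_gt0.
have T5 : 2 * 4 ^+ J * (beta * lam) = lam * 4 ^+ J / (2 * 2 ^+ 14).
  by rewrite /beta; field.
have T6 : lam * 4 ^+ J / 2 ^+ 14 <= (size s)%:R.
  by rewrite ler_pdivrMr// [leRHS]mulrC.
have p4 : 0 < lam * 4 ^+ J / 2 ^+ 14 by rewrite divr_gt0// mulr_gt0// exprn_gt0.
have T7 : lam * 4 ^+ J / (4 * 2 ^+ 14) = lam * 4 ^+ J / 2 ^+ 14 / 4.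
  by field.
have T8 : lam * 4 ^+ J / (2 * 2 ^+ 14) = lam * 4 ^+ J / 2 ^+ 14 / 2.
  by field.
move: T1 T2 T3 T4 p4 T6; rewrite T5 T7 T8.
move: (_ / 2 ^+ 14) => z; move: (_ / _) => v; clear; lra.
Qed.

End selection.

(** * The common point of a chain of windows *)

Lemma nested_intervals (R : realType) (a b : nat -> R) :
  (forall k, a k <= a k.+1) -> (forall k, b k.+1 <= b k) -> (forall k, a k <= b k) ->
  exists x, forall k, a k <= x <= b k.
Proof.
move=> a_mono b_mono ab.
have am k m : a k <= a (k + m)%N.
  by elim: m => [|m ih]; rewrite ?addn0// addnS (le_trans ih).
have bm k m : b (k + m)%N <= b k.
  by elim: m => [|m ih]; rewrite ?addn0// addnS (le_trans _ ih).
have abjk j k : a j <= b k.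
  by rewrite (le_trans (am j k))// (le_trans (ab _))// addnC.
have hs : has_sup (range a) by split; [exists (a 0%N), 0%N|exists (b 0%N) => _ [j _ <-]].
exists (sup (range a)) => k; apply/andP; split.
  by apply: ub_le_sup; [case: hs | exists k].
by apply: ge_sup; [case: hs | move=> _ [j _ <-]].
Qed.

Section window_limit.
Variables (R : realType) (psi r : nat -> R).
Hypothesis psi_gt0 : forall d, (0 < d)%N -> 0 < psi d.
Hypothesis psi_mono : forall d e, (0 < d)%N -> (d <= e)%N ->
  e%:R ^+ 2 * psi e <= d%:R ^+ 2 * psi d.
Hypothesis r_gt0 : forall d, (0 < d)%N -> 0 < r d.
Hypothesis r_lt : forall d, (0 < d)%N -> r d < psi d.

(** Unreduced fractions equal to [c] count as well. For [d = den c] the window gives the bound; a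
    proper multiple has [psi d <= psi (den c) / 4], since [psi] decreases at least like
    [1 / d ^ 2]. *)
Lemma window_center (c : rat) (x : R) (d : nat) :
  r (den c) <= psi (den c) / 4 -> window psi r c x -> (0 < d)%N -> (den c %| d)%N ->
  psi d - r d <= `|x - ratr c|.
Proof.
move=> rq /andP[x1 x2] d0 /dvdnP[k kd].
have P0 := psi_gt0 (den_gt0 c); have r0 := r_gt0 d0.
have xc : psi (den c) - r (den c) <= `|x - ratr c|.
  by rewrite (le_trans _ (ler_norm _))//; lra.
case: k kd => [|[|k]] kd; first by rewrite kd mul0n in d0.
  by move: xc; rewrite kd mul1n.
have cd : (den c <= d)%N by rewrite kd leq_pmull.
have m := psi_mono (den_gt0 c) cd.
have q0 := denR_gt0 R c.
have q2 : 2 * (den c)%:R <= d%:R :> R by rewrite -natrM ler_nat kd leq_mul2r orbT.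
have Pd := psi_gt0 d0.
have : 4 * psi d <= psi (den c).
  rewrite -(ler_pM2l (exprn_gt0 2 q0)); apply: le_trans m.
  rewrite mulrA ler_pM2r//.
  have -> : (den c)%:R ^+ 2 * 4 = (2 * (den c)%:R) ^+ 2 :> R by ring.
  by rewrite lerXn2r ?nnegrE ?mulr_ge0.
lra.
Qed.

Lemma window_avoid (c u : rat) (x : R) (d : nat) : window psi r c x ->
  (den u <= den c)%N -> (den u <= d)%N -> 2 * psi (den u) <= `|ratr c - ratr u| ->
  psi d - r d <= `|x - ratr u|.
Proof.
move=> /andP[x1 x2] uc ud h.
have P0 := psi_gt0 (den_gt0 c).
have d0 : (0 < d)%N by exact: leq_trans (den_gt0 u) ud.
have r0 := r_gt0 d0.
have p1 : psi (den c) <= psi (den u) by apply: (psi_le psi_gt0 psi_mono) => //; exact: den_gt0.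
have p2 : psi d <= psi (den u) by apply: (psi_le psi_gt0 psi_mono) => //; exact: den_gt0.
have xc : `|x - ratr c| <= psi (den c).
  have := r_lt (den_gt0 c); rewrite ler_norml; lra.
have := ler_distD x (ratr c) (ratr u); rewrite (distrC (ratr c) x); lra.
Qed.

Lemma window_limit (c : nat -> rat) :
  (forall q, (den (c 0%N) <= q)%N -> r q <= psi q / 4) ->
  isolated_rat psi (K0 R) (c 0%N) -> (forall k, child psi r (c k) (c k.+1)) ->
  exists x, [/\ forall k, window psi r (c k) x,
    infinite_set [set pq : int * nat | (0 < pq.2)%N /\
                    `|x - pq.1%:~R / pq.2%:R| <= psi pq.2] &
    forall d, (den (c 0%N) <= d)%N -> forall p : int,
      psi d - r d <= `|x - p%:~R / d%:R|].
Proof.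
move=> rq iso ch.
have rl k := r_lt (den_gt0 (c k)).
have r0 k := r_gt0 (den_gt0 (c k)).
have [x xP] : exists x, forall k, window psi r (c k) x.
  apply: nested_intervals => k.
  - by have [_ _ h1 _ _] := ch k; have := rl k.+1; lra.
  - by have [_ _ _ h2 _] := ch k.
  - by have := r0 k; lra.
exists x.
have dk k : (k + den (c 0%N) <= den (c k))%N.
  by elim: k => // k ih; have [h _ _ _ _] := ch k; rewrite addSn (leq_ltn_trans ih).
have rqk k : r (den (c k)) <= psi (den (c k)) / 4.
  by apply: rq; apply: leq_trans (dk k); exact: leq_addl.
split=> //.
  move=> /finite_seqP[s sE].
  pose k := (\max_(pq <- s) pq.2).+1.
  have : (numq (c k), den (c k)) \in s.
    have : [set` s] (numq (c k), den (c k)); last by [].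
    rewrite -sE/=; split; first exact: den_gt0.
    rewrite -ratr_num_den; have := xP k => /andP[x1 x2].
    by have := rl k; have := r0 k; rewrite ler_norml; lra.
  move=> /(@leq_bigmax_seq _ s xpredT (fun pq : int * nat => pq.2)) => /(_ isT)/=.
  apply/negP; rewrite -ltnNge; apply: leq_trans (dk k).
  by rewrite /k addSn ltnS leq_addr.
move=> d cd p.
have d0 : (0 < d)%N by exact: leq_trans (den_gt0 _) cd.
have [u ue] := frac_rat R p d0.
rewrite -ue; have ud := dvdn_den d0 ue.
(* Denominators up to the first one are handled by isolation of [c 0]; any larger one falls in the
   range of exactly one step of the chain. *)
have [uc0|uc0] := leqP (den u) (den (c 0%N)).
  have [uc|uNc] := eqVneq u (c 0%N).
    by rewrite uc; apply: window_center => //; rewrite -uc.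
  have h := iso u uNc uc0.
  have P0 := psi_gt0 (den_gt0 (c 0%N)).
  have h2 : 2 * psi (den (c 0%N)) <= `|ratr (c 0%N) - ratr u|.
    apply: le_trans h; rewrite /hpsi.
    have u0 := denR_gt0 R u.
    rewrite ler_pdivlMr ?exprn_gt0// mulrAC.
    apply: (@le_trans _ _ (2 * (den (c 0%N))%:R ^+ 2 * psi (den (c 0%N)))).
      rewrite ler_pM2r// ler_pM2l// lerXn2r ?nnegrE//.
      by rewrite ler_nat.
    rewrite mulrA ler_pM2r// ler_wpM2r ?exprn_ge0// /K0.
    lra.
  have := xP 0%N => /andP[x1 x2].
  have xc : `|x - ratr (c 0%N)| <= psi (den (c 0%N)).
    by have := rl 0%N; have := r0 0%N; rewrite ler_norml; lra.
  have p2 : psi d <= psi (den (c 0%N)) by apply: (psi_le psi_gt0 psi_mono) => //; exact: den_gt0.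
  have rd0 := r_gt0 d0.
  by have := ler_distD x (ratr (c 0%N)) (ratr u); rewrite (distrC (ratr (c 0%N)) x); lra.
have [k k1] : exists k, (den (c k) < den u <= den (c k.+1))%N.
  have ex : exists k, (den u <= den (c k))%N.
    by exists (den u); apply: leq_trans (dk _); exact: leq_addr.
  case: (ex_minnP ex) => -[|k] hk mk; first by rewrite leqNgt uc0 in hk.
  exists k; rewrite hk andbT ltnNge; apply/negP => /mk; rewrite ltnn//.
have [uc|uNc] := eqVneq u (c k.+1).
  by rewrite uc; apply: window_center => //; rewrite -uc.
have [_ _ _ _ av] := ch k.
apply: (@window_avoid (c k.+1)) => //; [by case/andP: k1 | exact: dvdn_leq | exact: av].
Qed.

End window_limit.

(** * A point of the exact set outside a given cover *)

Section escape.
Variables (R : realType) (psi r : nat -> R) (S : R).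
Hypothesis psi_gt0 : forall d, (0 < d)%N -> 0 < psi d.
Hypothesis psi_mono : forall d e, (0 < d)%N -> (d <= e)%N ->
  e%:R ^+ 2 * psi e <= d%:R ^+ 2 * psi d.
Hypothesis psi_sum : forall n, \sum_(1 <= q < n) q%:R * psi q <= S.
Hypothesis psi_div : forall q, (0 < q)%N ->
  exists m : nat, psi q = 1 / (q%:R ^+ 2 * m%:R).
Hypothesis r_gt0 : forall d, (0 < d)%N -> 0 < r d.
Hypothesis r_lt : forall d, (0 < d)%N -> r d < psi d.
Hypothesis r_mono : forall d e, (0 < d)%N -> (d <= e)%N -> r e <= r d.
Hypothesis r_le : \forall q \near \oo, r q <= psi q / 4.
Hypothesis r_ge : \forall q \near \oo, forall N : nat,
  psi q * N%:R = 1 -> 100 * psi N <= r q.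
Variable t : R.
Hypothesis t_gt0 : 0 < t.
Hypothesis t_le1 : t <= 1.
Hypothesis r_big : forall (M : R) (J0 : nat), exists2 J : nat,
  (J0 <= J)%N & M <= 4 ^+ J * r (2 ^ J) `^ t.

Lemma isolated_start (q : nat) : exists2 c, (q <= den c)%N & isolated_rat psi (K0 R) c.
Proof.
have K00 : 0 < K0 R by rewrite mulr_gt0.
have [J0 _ hJ0] := isolated_rats psi_gt0 psi_mono psi_sum K00 (@ltr01 R) (@ltr01 R).
pose J := maxn J0 (q + 10).
have /(_ [::]) [|s [_ ss sP]] := hJ0 J (leq_maxl _ _).
  by rewrite big_nil subr0 divr_ge0.
case: s ss sP => [|c s] ss sP.
  by move: ss; rewrite subr0 mul1r mulr0 leNgt exprn_gt0.
have [/andP[h1 _] _ iso _] := sP c (mem_head _ _).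
exists c => //; apply: leq_trans h1; apply: ltnW.
apply: (leq_trans (ltn_expl q (isT : (1 < 2)%N))).
by rewrite leq_exp2l// leq_subRL ?(leq_trans (leq_addl q 10)) ?leq_maxr// addnC leq_maxr.
Qed.

(** The value of [e] makes the starting rational sparse whatever the cover, so [e] and [q0] are
    fixed before it. Sparsity then passes down a chain of children. *)
Lemma escape : exists e (q0 : nat), 0 < e /\
  forall (U : nat -> set R) (d : nat -> R),
    (forall i, 0 < d i) -> (forall i x y, U i x -> U i y -> `|x - y| <= d i) ->
    (forall n, \sum_(0 <= i < n) d i `^ t <= e) ->
  exists x, [/\ forall i, ~ U i x,
    infinite_set [set pq : int * nat | (0 < pq.2)%N /\
                    `|x - pq.1%:~R / pq.2%:R| <= psi pq.2] &
    forall q, (q0 <= q)%N -> forall p : int,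
      psi q - r q <= `|x - p%:~R / q%:R|].
Proof.
have [q1 _ ch] := many_children psi_gt0 psi_mono psi_sum psi_div r_gt0 r_le r_ge.
have [q2 _ rq] := r_le.
pose q3 := maxn q1 q2.
have [c0 c0q iso0] := isolated_start q3.
have b0 := beta_gt0 R.
exists ((beta R * r (den c0)) `^ t), (den c0); split.
  by rewrite powR_gt0// mulr_gt0// r_gt0// den_gt0.
move=> U d d0 Ud dsum.
pose good c := [/\ (q3 <= den c)%N, isolated_rat psi (K0 R) c & sparse psi r t U d c].
have good0 : good c0.
  split => // n; apply: le_trans (dsum n); rewrite big_mkcond; apply: ler_sum => i _.
  by case: ifP => // _; exact: powR_ge0.
have step c : exists c', good c -> child psi r c c' /\ good c'.
  have [[cq iso sp]|ng] := pselect (good c); last by exists c.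
  have lam0 := r_gt0 (den_gt0 c).
  have q1c : (q1 <= den c)%N by apply: leq_trans cq; exact: leq_maxl.
  have [J0 _ hJ0] := ch _ q1c c erefl iso.
  have [J JJ0 big] := r_big (8 * 2 ^+ 14 * r (den c) `^ t / r (den c)) J0.
  have [s [us ss sP]] := hJ0 J JJ0.
  have {}big : 8 * 2 ^+ 14 * r (den c) `^ t <= r (den c) * 4 ^+ J * r (2 ^ J) `^ t.
    by move: big; rewrite ler_pdivrMr// => /le_trans; apply; rewrite [leLHS]mulrC mulrA.
  have [c' c's sc'] := select_child r_gt0 r_lt r_mono t_gt0 t_le1 d0 Ud us sp ss big sP.
  exists c' => _; have [_ cc' _] := sP _ c's; split => //; have [h1 h2 _ _ _] := cc'.
  by split => //; rewrite (leq_trans cq)// ltnW.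
have [f fP] := choice step.
pose c k := iter k f c0.
have gc k : good (c k) by elim: k => // k ih; exact: (proj2 (fP _ ih)).
have cc k : child psi r (c k) (c k.+1) by exact: (proj1 (fP _ (gc k))).
have rq0 q : (den (c 0%N) <= q)%N -> r q <= psi q / 4.
  by move=> hq; apply: rq; apply: leq_trans hq; apply: leq_trans c0q; exact: leq_maxr.
have [x [xP xW xE]] := window_limit psi_gt0 psi_mono r_gt0 r_lt rq0 iso0 cc.
exists x; split => // i Ux.
(* If [x] were in [U i], every window of the chain would meet [U i], so sparsity would bound [d i]
   by [beta * r (den (c k))] for all [k]; at [n0] this is already smaller than [d i]. *)
have [n0 _ hn0] := hpsi_small psi_gt0 psi_mono psi_sum (d0 i).
have dk k : (k <= den (c k))%N.
  by elim: k => // k ih; have [h _ _ _ _] := cc k; exact: leq_ltn_trans ih h.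
have := hn0 _ (dk n0) => /=.
have [_ _ sp] := gc n0.
have mi : window_meets psi r U i (c n0) by apply/asboolP; exists x.
move=> hd; have := sparse_term sp mi; apply/negP; rewrite -ltNge.
have P0 := psi_gt0 (den_gt0 (c n0)); have r0 := r_gt0 (den_gt0 (c n0)).
apply: gt0_ltr_powR; rewrite ?nnegrE //; try exact: ltW.
  by rewrite ltW// mulr_gt0.
apply: (@le_lt_trans _ _ (r (den (c n0)))).
  rewrite ler_piMl ?ltW// /beta ltr_pdivrMr ?mulr_gt0 ?exprn_gt0// mul1r.
  by rewrite -natrX -natrM ltr1n.
apply: lt_le_trans (r_lt (den_gt0 _)) _; apply: le_trans hd.
by rewrite /hpsi ler_peMl ?exprn_ege1 ?den_ge1// ltW.
Qed.

End escape.

(** * Series with non-negative terms *)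

Section series.
Variable R : realType.
Implicit Types (u : nat -> R).

Lemma summable_bounded u m : (forall n, 0 <= u n) ->
  (\sum_(m <= q <oo) (u q)%:E < +oo)%E -> exists S, forall n, \sum_(m <= q < n) u q <= S.
Proof.
move=> u0; set T := (\sum_(m <= q <oo) _)%E => Tfin.
have uE q : (0 <= (u q)%:E)%E by rewrite lee_fin.
have T0 : (0 <= T)%E by apply: nneseries_ge0 => *; exact: uE.
exists (fine T) => n; rewrite -lee_fin fineK ?ge0_fin_numE// -sumEFin.
by apply: nneseries_lim_ge => *; exact: uE.
Qed.

Lemma bounded_summable u m S : (forall n, 0 <= u n) ->
  (forall n, \sum_(m <= q < n) u q <= S) -> (\sum_(m <= q <oo) (u q)%:E <= S%:E)%E.
Proof.
move=> u0 uS; apply: lime_le.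
  by apply: is_cvg_nneseries => n _ _; rewrite lee_fin.
by apply: nearW => n; rewrite sumEFin lee_fin.
Qed.

Lemma sum_if_lt_le (m n : nat) (v : R) : 0 <= v ->
  \sum_(0 <= k < n) (if (k < m)%N then v else 0) <= m%:R * v.
Proof.
move=> v0; suff : \sum_(0 <= k < n) (if (k < m)%N then v else 0) <= (minn n m)%:R * v.
  by move=> /le_trans; apply; rewrite ler_wpM2r// ler_nat geq_minr.
elim: n => [|n ih]; first by rewrite big_geq// min0n mul0r.
rewrite big_nat_recr//=; case: ltnP => nm.
  have e1 : minn n.+1 m = n.+1 by apply/minn_idPl.
  have e2 : minn n m = n by apply/minn_idPl; exact: ltnW.
  by move: ih; rewrite e1 e2 -natr1 mulrDl mul1r lerD2r.
have e1 : minn n.+1 m = m by apply/minn_idPr; exact: leqW.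
have e2 : minn n m = m by apply/minn_idPr.
by move: ih; rewrite e1 e2 addr0.
Qed.

Lemma sum_exp2VS_le n : \sum_(0 <= j < n) (2 ^+ j.+1)^-1 <= 1 :> R.
Proof.
suff h : \sum_(0 <= j < n) (2 ^+ j.+1)^-1 <= 1 - (2 ^+ n)^-1 :> R.
  by apply: le_trans h _; rewrite gerBl invr_ge0 exprn_ge0.
elim: n => [|n ih]; first by rewrite big_geq// expr0 invr1 subrr.
rewrite big_nat_recr//= (le_trans (lerD ih (lexx _)))// exprS invfM; lra.
Qed.

Lemma esum_nat (a : nat -> \bar R) : (forall i, 0 <= a i)%E ->
  (\esum_(i in [set: nat]) a i = \sum_(0 <= i <oo) a i)%E.
Proof.
by move=> a0; rewrite nneseries_esum//; congr esum; apply/seteqP; split.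
Qed.

Lemma esum_pair (T1 T2 : choiceType) (a : T1 * T2 -> \bar R) : (forall i, 0 <= a i)%E ->
  (\esum_(k in [set: T1 * T2]) a k =
   \esum_(i in [set: T1]) \esum_(j in [set: T2]) a (i, j))%E.
Proof.
move=> a0; rewrite (@esum_esum R T1 T2 setT (fun=> setT) (fun i j => a (i, j)))//.
rewrite (_ : _ `*`` _ = [set: T1 * T2]); last by apply/seteqP; split.
by apply: eq_esum => -[].
Qed.

End series.

(** * Covers and Hausdorff measure *)

Section hausdorff_covers.
Variable R : realType.
Implicit Types (A V : set R) (s delta : R).

Lemma diam_ge0 V : V !=set0 -> (0 <= diam V)%E.
Proof.
move=> [x Vx]; apply: ereal_sup_ubound; exists x => //; exists x => //.
by rewrite subrr normr0.
Qed.

Lemma le_diam V x y : V x -> V y -> (`|x - y|%:E <= diam V)%E.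
Proof. by move=> Vx Vy; apply: ereal_sup_ubound; exists x => //; exists y. Qed.

Lemma diam_le V rho : (forall x y, V x -> V y -> `|x - y| <= rho) -> (diam V <= rho%:E)%E.
Proof. by move=> h; apply: ge_ereal_sup => _ [x Vx [y Vy <-]]; rewrite lee_fin h. Qed.

Lemma diam_pow_ge0 s V : (0 <= diam_pow s V)%E.
Proof. by rewrite /diam_pow; case: ifP => // _; exact: poweR_ge0. Qed.

Lemma diam_pow_le s V rho : 0 <= s -> 0 <= rho ->
  (forall x y, V x -> V y -> `|x - y| <= rho) -> (diam_pow s V <= (rho `^ s)%:E)%E.
Proof.
move=> s0 rho0 h; rewrite /diam_pow; case: ifPn => [_|/set0P V0].
  by rewrite lee_fin powR_ge0.
rewrite -poweR_EFin; apply: gt0_ler_poweR => //; last exact: diam_le.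
- by rewrite in_itv/= diam_ge0// leey.
- by rewrite in_itv/= lee_fin rho0 leey.
Qed.

Lemma hausdorff_premeasure_le_esum (I : countType) s delta A (F : I -> set R) :
  A `<=` \bigcup_i F i -> (forall i, (diam (F i) <= delta%:E)%E) -> 0 <= delta ->
  (hausdorff_premeasure s delta A <= \esum_(i in [set: I]) diam_pow s (F i))%E.
Proof.
move=> AF Fd d0.
pose U n : set R := if (pickle_inv n : option I) is Some i then F i else set0.
have Upickle i : U (pickle i) = F i by rewrite /U pickleK_inv.
have -> : (\esum_(i in [set: I]) diam_pow s (F i) = \sum_(i <oo) diam_pow s (U i))%E.
  rewrite nneseries_esum; last by move=> *; exact: diam_pow_ge0.
  rewrite (_ : [set x | xpredT x] = setT); last by apply/seteqP; split.
  rewrite [RHS](_ : _ = \esum_(j in range (pickle : I -> nat)) diam_pow s (U j))%E; last first.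
    rewrite [RHS]esum_mkcond; apply: eq_esum => n _; case: ifPn => // nr.
    rewrite /U /diam_pow; have := @pickle_invK I n; rewrite /ocancel.
    case: (pickle_inv n) => [i /= e|_]; last by rewrite eqxx.
    by case/negP: nr; rewrite inE; exists i.
  rewrite (@reindex_esum R I nat setT (range pickle) pickle) //; last first.
    split; first by move=> i _; exists i.
      by move=> i j _ _; exact: (pcan_inj pickleK).
    by move=> _ [i _ <-]; exists i.
  by apply: eq_esum => i _; rewrite Upickle.
apply: ereal_inf_lbound; exists U => //; split.
  by move=> x /AF[i _ Fx]; exists (pickle i) => //; rewrite Upickle.
move=> n; rewrite /U; case: pickle_inv => // .
by apply: diam_le.
Qed.

(** A cover at scale 1 has diameters at most 1, so raising the exponent from [s] to [t] does not
    increase their powers. Adding a geometric term makes every [c i] positive, and its [t]-th root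
    [d i] still bounds the diameter of [U i]. *)
Lemma null_cover s t e A : 0 <= s -> s < t -> 0 < e -> hausdorff_measure s A = 0%E ->
  exists (U : nat -> set R) (d : nat -> R), [/\ A `<=` \bigcup_i U i,
    forall i, 0 < d i, forall i x y, U i x -> U i y -> `|x - y| <= d i &
    forall n, \sum_(0 <= i < n) d i `^ t <= e].
Proof.
move=> s0 st e0 H0; have t0 : 0 < t by exact: le_lt_trans s0 st.
have e2 : 0 < e / 2 by rewrite divr_gt0.
have : (hausdorff_premeasure s 1 A < (e / 2)%:E)%E.
  apply: (@le_lt_trans _ _ 0%E); last by rewrite lte_fin.
  by rewrite -[leRHS]H0; apply: ereal_sup_ubound; exists 1 => //; exact: ltr01.
move=> /ereal_inf_lt[_ [U [AU U1] <-] Ue].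
pose D i := diam_pow s (U i).
have D0 i : (0 <= D i)%E by exact: diam_pow_ge0.
have Dsum n : (\sum_(0 <= i < n) D i < (e / 2)%:E)%E.
  by apply: le_lt_trans Ue; apply: nneseries_lim_ge => *; exact: diam_pow_ge0.
have Dfin i : D i \is a fin_num.
  rewrite ge0_fin_numE//; apply: (@le_lt_trans _ _ (\sum_(0 <= j < i.+1) D j)%E).
    by rewrite big_nat_recr//= leeDr// sume_ge0.
  by apply: lt_trans (Dsum _) _; rewrite ltry.
pose c i := fine (D i) + e / 2 / 2 ^+ i.+1.
have c0 i : 0 < c i by rewrite ltr_wpDl ?fine_ge0// !divr_gt0// exprn_gt0.
exists U, (fun i => c i `^ t^-1); split => //.
- by move=> i; exact: powR_gt0.
- move=> i x y Ux Uy; have [->|xy] := eqVneq x y.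
    by rewrite subrr normr0 powR_ge0.
  set v := `|x - y|; have v0 : 0 < v by rewrite normr_gt0 subr_eq0.
  have v1 : v <= 1 by rewrite -lee_fin; apply: le_trans (U1 i); exact: le_diam.
  have vD : v `^ s <= fine (D i).
    rewrite -lee_fin fineK// /D /diam_pow; case: ifPn => [/eqP U0|_].
      by move: Ux; rewrite U0.
    rewrite -poweR_EFin; apply: gt0_ler_poweR => //.
    + by rewrite in_itv/= lee_fin leey ltW.
    + by rewrite in_itv/= diam_ge0 ?leey//; exists x.
    + exact: le_diam.
  have vt : v `^ t <= c i.
    apply: (@le_trans _ _ (v `^ s)); last first.
      by rewrite (le_trans vD)// lerDl !divr_ge0 ?ltW// exprn_gt0.
    by apply: ger_powR; [rewrite v0 v1 | exact: ltW].
  have -> : v = (v `^ t) `^ t^-1 by rewrite -powRrM divff ?gt_eqF// powRr1// ltW.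
  by apply: ge0_ler_powR; rewrite ?invr_ge0 ?nnegrE ?powR_ge0// ltW.
- move=> n; have E i : (c i `^ t^-1) `^ t = c i.
    by rewrite -powRrM mulVf ?gt_eqF// powRr1// ltW.
  under eq_bigr do rewrite E.
  rewrite big_split/=.
  have h1 : \sum_(0 <= i < n) fine (D i) <= e / 2.
    rewrite -lee_fin -sumEFin; apply: le_trans (ltW (Dsum n)).
    by apply: lee_sum => i _; rewrite fineK.
  have h2 : \sum_(0 <= i < n) e / 2 / 2 ^+ i.+1 <= e / 2.
    have e2' := ltW e2.
    rewrite -mulr_sumr ler_piMr//.
    exact: sum_exp2VS_le.
  lra.
Qed.

End hausdorff_covers.

(** * The upper bound: covering by half annuli *)

Section upper_bound.
Variables (R : realType) (Psi omega : R -> R).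
Local Notation r q := (Psi q%:R * omega q%:R).
Hypothesis psi_gt0 : forall d : nat, (0 < d)%N -> 0 < Psi d%:R.
Hypothesis psi_mono : forall d e : nat, (0 < d)%N -> (d <= e)%N ->
  e%:R ^+ 2 * Psi e%:R <= d%:R ^+ 2 * Psi d%:R.
Hypothesis r_gt0 : forall d : nat, (0 < d)%N -> 0 < r d.
Hypothesis r_lt : forall d : nat, (0 < d)%N -> r d < Psi d%:R.

Lemma Psi_le_inv q : (0 < q)%N -> Psi q%:R <= Psi 1 / q%:R.
Proof.
move=> q0; have := psi_mono (isT : (0 < 1)%N) q0; rewrite expr1n mul1r => h.
have Q0 : 0 < q%:R :> R by rewrite ltr0n.
have Q1 : 1 <= q%:R :> R by rewrite ler1n.
rewrite ler_pdivlMr//; apply: le_trans h.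
by rewrite mulrC ler_pM2r ?psi_gt0// expr2 ler_peMl// ltW.
Qed.

Lemma absz_le_of_close (x : R) (p : int) (q : nat) : (0 < q)%N ->
  `|x - p%:~R / q%:R| <= Psi q%:R -> (absz p)%:R <= (`|x| + Psi 1) * q%:R.
Proof.
move=> q0 h; have Q0 : 0 < q%:R :> R by rewrite ltr0n.
have Pq : Psi q%:R <= Psi 1.
  apply: le_trans (Psi_le_inv q0) _; rewrite ler_pdivrMr// ler_peMr ?ler1n// ltW//.
  exact: (psi_gt0 (isT : (0 < 1)%N)).
rewrite -ler_pdivrMr//.
have -> : (absz p)%:R / q%:R = `|p%:~R / q%:R| :> R.
  by rewrite normrM normfV (gtr0_norm Q0) natr_absz intr_norm.
have -> : p%:~R / q%:R = x - (x - p%:~R / q%:R) :> R by ring.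
by apply: le_trans (ler_normB _ _) _; rewrite lerD2l (le_trans h).
Qed.

Lemma W_set_large x M : W_set Psi x -> exists (p : int) (q : nat),
  [/\ (M <= q)%N, (0 < q)%N & `|x - p%:~R / q%:R| <= Psi q%:R].
Proof.
move=> Wx; apply: contrapT => no; apply: Wx.
pose n := Num.bound ((`|x| + Psi 1) * M%:R).
apply: (@sub_finite_set _ _ ([set p : int | (`|p| <= n)%N] `*` `I_M)); last first.
  apply: finite_setX; last exact: finite_II.
  apply: (@sub_finite_set _ _ ((fun k : nat => k%:Z - n%:Z) @` `I_(2 * n).+1)).
    move=> p /= pn; exists (absz (p + n%:Z)); move: pn; clear; rewrite /= ; lia.
  exact/finite_image/finite_II.
move=> [p q] /= [q0 h]; have qM : (q < M)%N.
  by rewrite ltnNge; apply/negP => Mq; apply: no; exists p, q.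
split => //=; rewrite -(ler_nat R).
have P1 := psi_gt0 (isT : (0 < 1)%N).
have c0 : 0 <= `|x| + Psi 1 by rewrite addr_ge0// ltW.
apply: le_trans (absz_le_of_close q0 h) _.
apply: (@le_trans _ _ ((`|x| + Psi 1) * M%:R)).
  by rewrite ler_wpM2l// ler_nat ltnW.
by rewrite ltW// archi_boundP// mulr_ge0.
Qed.

(** The centre has numerator of absolute value [B * q + k %/ 4]; the last two binary digits of [k]
    are the sign of the numerator and the side of the centre. The threshold on [q] depends on [B],
    so that the whole line is covered at once at arbitrarily small cost. *)
Definition annulus (N : nat -> nat) (i : nat * (nat * nat)) : set R :=
  let: (B, (q, k)) := i in
  [set x | [/\ (0 < q)%N, (N B <= q)%N, (k < 4 * q)%N &
    Psi q%:R - r q <= (-1) ^+ odd k./2 *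
      (x - (-1) ^+ odd k * ((B * q + k %/ 4)%:R / q%:R)) <= Psi q%:R]].

Lemma annulus_dist N i x y : annulus N i x -> annulus N i y -> `|x - y| <= r i.2.1.
Proof.
move: i => [B [q k]] /= [_ _ _ hx] [_ _ _ hy]; move: hx hy.
by case: (odd k./2); rewrite ?expr1 ?expr0 ler_norml; lra.
Qed.

(** For a fixed [x] only [B < M] can occur, whatever [q], so beyond the largest of finitely many
    thresholds every approximation is admissible. *)
Lemma E_set_sub_annuli N : E_set Psi omega `<=` \bigcup_i annulus N i.
Proof.
move=> x [Wx [q0 _ Ex]].
have P1 := psi_gt0 (isT : (0 < 1)%N).
pose M := Num.bound (`|x| + Psi 1).
have MP : `|x| + Psi 1 < M%:R by rewrite archi_boundP// addr_ge0// ltW.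
have [p [q [qM Q0 h]]] := W_set_large (maxn q0 (\max_(B < M) N B)) Wx.
have [q0q Nq] : (q0 <= q)%N /\ (\max_(B < M) N B <= q)%N.
  by move: qM; rewrite geq_max => /andP.
have Q'0 : 0 < q%:R :> R by rewrite ltr0n.
have h2 := Ex q q0q p; rewrite /= in h2.
pose n := absz p; pose B := (n %/ q)%N; pose j := (n %% q)%N.
have nE : n = (B * q + j)%N by exact: divn_eq.
have jq : (j < q)%N by rewrite ltn_mod.
have BM : (B < M)%N.
  rewrite -(ltr_nat R); apply: le_lt_trans MP.
  rewrite -(ler_pM2r Q'0); apply: le_trans (absz_le_of_close Q0 h).
  by rewrite -natrM ler_nat leq_trunc_div.
have NB : (N B <= q)%N.
  by apply: leq_trans Nq; exact: (@leq_bigmax _ (fun B : 'I_M => N B) (Ordinal BM)).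
pose tau : bool := p < 0; pose sg : bool := x - p%:~R / q%:R < 0.
pose k := (4 * j + (2 * sg + tau))%N.
have k4 : (k %/ 4 = j)%N by rewrite /k; clear; case: sg; case: tau; lia.
have k1 : odd k = tau by rewrite /k; clear; case: sg; case: tau; lia.
have k2 : odd k./2 = sg by rewrite /k; clear; case: sg; case: tau; lia.
exists (B, (q, k)) => //; split => //.
  by rewrite /k; move: jq; clear; case: sg; case: tau; lia.
rewrite k4 k1 k2 -nE.
have -> : (-1) ^+ tau * (n%:R / q%:R) = p%:~R / q%:R :> R.
  rewrite mulrA; congr (_ / _); rewrite /n natr_absz /tau; case: ltrP => p0.
    by rewrite expr1 mulN1r ltr0_norm// mulrNz opprK.
  by rewrite expr0 mul1r ger0_norm.
have -> : (-1) ^+ sg * (x - p%:~R / q%:R) = `|x - p%:~R / q%:R|.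
  rewrite /sg; case: ltrP => s0; first by rewrite expr1 mulN1r ltr0_norm.
  by rewrite expr0 mul1r ger0_norm.
by rewrite h andbT; move: h2; rewrite mulrBl mul1r [omega _ * _]mulrC.
Qed.

(** For each [B] there are [4 * q] half annuli of denominator [q], so the tail of the series from
    [N B] on can be made at most [e / 2 ^ B.+1]; these bounds sum to [e]. *)
Lemma hausdorff_measure_E_set0 s : 0 <= s ->
  (\sum_(1 <= q <oo) (q%:R * (Psi q%:R * omega q%:R) `^ s)%:E < +oo)%E ->
  hausdorff_measure s (E_set Psi omega) = 0%E.
Proof.
move=> s0 sumr; pose v q : R := q%:R * r q `^ s.
have v0 q : 0 <= v q by rewrite mulr_ge0// powR_ge0.
have [S hS] := summable_bounded v0 sumr.
have hS0 n : \sum_(0 <= q < n) v q <= S.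
  have S0 : 0 <= S by have := hS 0%N; rewrite big_geq.
  case: n => [|n]; first by rewrite big_geq.
  by rewrite big_ltn// {1}/v mul0r add0r.
apply/eqP; rewrite eq_le; apply/andP; split; last first.
  apply: (@le_trans _ _ (hausdorff_premeasure s 1 (E_set Psi omega))).
    apply: le_ereal_inf_tmp => _ [U _ <-]; apply: nneseries_ge0 => *.
    exact: diam_pow_ge0.
  by apply: ereal_sup_ubound; exists 1 => //; exact: ltr01.
apply: ge_ereal_sup => _ [delta delta0 <-] /=.
apply/lee_addgt0Pr => e e0; rewrite add0e.
have /choice[N NP] : forall B : nat, exists N, [/\ (0 < N)%N,
    (forall n, \sum_(N <= q < n) 4 * v q <= e / (2 ^ B.+1)%:R) &
    forall q, (N <= q)%N -> r q <= delta].
  move=> B; have eB : 0 < e / (2 ^ B.+1)%:R / 4 by rewrite !divr_gt0// ltr0n expn_gt0.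
  have [N1 hN1] := sum_tail_le v0 hS0 eB.
  have P1 := psi_gt0 (isT : (0 < 1)%N).
  pose N2 := Num.bound (Psi 1 / delta).
  exists (maxn 1 (maxn N1 N2)); split; first by rewrite leq_max.
    move=> n; rewrite -mulr_sumr mulrC -ler_pdivlMr//.
    apply: le_trans (hN1 n); have [h|h] := leqP n (maxn 1 (maxn N1 N2)).
      by rewrite big_geq// sumr_ge0.
    have h' : (N1 <= maxn 1 (maxn N1 N2))%N by rewrite !leq_max leqnn orbT.
    by rewrite [leRHS](big_cat_nat h' (ltnW h))/= lerDr sumr_ge0.
  move=> q; rewrite !geq_max => /and3P[q1 _ N2q].
  have Q0 : 0 < q%:R :> R by rewrite ltr0n.
  apply: ltW; apply: lt_le_trans (r_lt q1) _; apply: le_trans (Psi_le_inv q1) _.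
  rewrite ler_pdivrMr// mulrC -ler_pdivrMr//.
  have b0 : 0 <= Psi 1 / delta by rewrite divr_ge0 ?ltW.
  by apply: le_trans (ltW (archi_boundP b0)) _; rewrite ler_nat.
apply: le_trans (@hausdorff_premeasure_le_esum R _ s delta _ (annulus N) _ _ (ltW delta0)) _.
- exact: E_set_sub_annuli.
- move=> [B [q k]]; have [[x Fx]|nF] := pselect (annulus N (B, (q, k)) !=set0).
    have [_ _ hB] := NP B; have [_ Nq _ _] := Fx.
    apply: diam_le => y z Fy Fz; apply: le_trans (hB q Nq).
    exact: (@annulus_dist N (B, (q, k))).
  by apply: diam_le => y z Fy; case: nF; exists y.
(* Outside the two conditions the annulus is empty and [diam_pow] is 0, also for [s = 0]. *)
pose g (B q k : nat) : R := if (N B <= q)%N then (if (k < 4 * q)%N then r q `^ s else 0) else 0.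
have g0 B q k : 0 <= g B q k by rewrite /g; do 2 case: ifP => // _; exact: powR_ge0.
have dg (i : nat * (nat * nat)) : (diam_pow s (annulus N i) <= (g i.1 i.2.1 i.2.2)%:E)%E.
  have [[x Fx]|nF] := pselect (annulus N i !=set0); last first.
    rewrite /diam_pow; case: ifPn => [_|/set0P//]; by rewrite lee_fin.
  move: i Fx => [B [q k]] Fx; have [q0 Nq k4 _] := Fx.
  have -> : g (B, (q, k)).1 (B, (q, k)).2.1 (B, (q, k)).2.2 = r q `^ s by rewrite /g/= Nq k4.
  apply: diam_pow_le => //; first exact/ltW/r_gt0.
  exact: (@annulus_dist N (B, (q, k))).
apply: (@le_trans _ _ (\esum_(i in [set: nat * (nat * nat)]) (g i.1 i.2.1 i.2.2)%:E)%E).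
  by apply: le_esum => i _; exact: dg.
rewrite esum_pair; last by move=> i; rewrite lee_fin.
rewrite esum_nat; last by move=> B; apply: esum_ge0 => *; rewrite lee_fin.
have := @epsilon_trick R (fun=> 0%E) e xpredT (fun=> lexx _) (ltW e0).
rewrite [X in (_ <= X + _)%E]eseries0// add0e.
apply: le_trans; apply: lee_nneseries => [B _ _|B _].
  by apply: esum_ge0 => *; rewrite lee_fin.
rewrite add0e esum_pair/=; last by move=> i; rewrite lee_fin.
rewrite esum_nat; last by move=> q; apply: esum_ge0 => *; rewrite lee_fin.
have [N0 hN _] := NP B.
pose w q := if (N B <= q)%N then 4 * v q else 0.
have w0 q : 0 <= w q by rewrite /w; case: ifP => // _; rewrite mulr_ge0.
apply: (@le_trans _ _ (\sum_(0 <= q <oo) (w q)%:E)%E).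
  apply: lee_nneseries => [q _ _|q _]; first by apply: esum_ge0 => *; rewrite lee_fin.
  rewrite esum_nat; last by move=> k; rewrite lee_fin.
  apply: bounded_summable => // n; rewrite /g /w; case: ifPn => _; last by rewrite big1.
  apply: le_trans (sum_if_lt_le _ _ (powR_ge0 _ _)) _.
  by rewrite natrM /v mulrA.
apply: bounded_summable => // n; apply: le_trans (hN n).
have [h|h] := leqP n (N B).
  rewrite [leRHS]big_geq// big_nat_cond big1// => q; rewrite andbT => /andP[_ qn].
  by rewrite /w leqNgt (leq_trans qn h).
rewrite (big_cat_nat (leq0n (N B)) (ltnW h))/= big_nat_cond big1 ?add0r.
  by apply: ler_sum_nat => q /andP[Nq _]; rewrite /w Nq.
by move=> q; rewrite andbT => /andP[_ qN]; rewrite /w leqNgt qN.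
Qed.

End upper_bound.

(** * Divergence of the series read on powers of two *)

Lemma geometric_sum_le (R : realType) (z : R) n : 0 <= z < 1 ->
  \sum_(0 <= j < n) z ^+ j <= 1 / (1 - z).
Proof.
move=> /andP[z0 z1]; have z1' : 0 < 1 - z by rewrite subr_gt0.
suff -> : \sum_(0 <= j < n) z ^+ j = (1 - z ^+ n) / (1 - z).
  by rewrite ler_pM2r ?invr_gt0// gerBl exprn_ge0.
elim: n => [|n ih]; first by rewrite big_geq// expr0 subrr mul0r.
by rewrite big_nat_recr//= ih exprS; field; rewrite gt_eqF.
Qed.

Section dyadic_divergence.
Variables (R : realType) (r : nat -> R) (t t' : R).
Hypothesis r_gt0 : forall d, (0 < d)%N -> 0 < r d.
Hypothesis r_mono2 : forall d e, (0 < d)%N -> (d <= e)%N ->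
  e%:R ^+ 2 * r e <= d%:R ^+ 2 * r d.
Hypothesis t_gt0 : 0 < t.
Hypothesis tt' : t < t'.

Lemma sum_dyadic_powR_le n : \sum_(1 <= q < 2 ^ n) q%:R * r q `^ t' <=
  2 * \sum_(0 <= j < n) 4 ^+ j * r (2 ^ j) `^ t'.
Proof.
have t'0 : 0 <= t' by apply: ltW; apply: lt_trans tt'.
elim: n => [|n ih]; first by rewrite !big_geq// mulr0.
have n0 : (1 <= 2 ^ n)%N by rewrite expn_gt0.
have nn : (2 ^ n <= 2 ^ n.+1)%N by rewrite leq_exp2l.
rewrite (big_cat_nat n0 nn)/= big_nat_recr//= mulrDr; apply: lerD => //.
apply: (@le_trans _ _ (\sum_(2 ^ n <= q < 2 ^ n.+1) (2 ^ n.+1)%:R * r (2 ^ n) `^ t')).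
  apply: ler_sum_nat => q /andP[nq qn]; apply: ler_pM => //; rewrite ?powR_ge0//.
    by rewrite ler_nat ltnW.
  have q0 : (0 < q)%N by exact: leq_trans nq.
  apply: ge0_ler_powR => //; last exact: (psi_le r_gt0 r_mono2).
    by rewrite nnegrE ltW// r_gt0.
  by rewrite nnegrE ltW// r_gt0.
have e : (2 ^ n.+1 - 2 ^ n = 2 ^ n)%N by rewrite expnS mul2n -addnn addnK.
rewrite sumr_const_nat e -[leLHS]mulr_natl exp4E natrX expnS natrM natrX.
rewrite le_eqVlt; apply/orP; left; apply/eqP; ring.
Qed.

(** If [4 ^ J * r (2 ^ J) ^ t] were bounded, then, as [r (2 ^ J) <= r 1 / 4 ^ J], the larger
    exponent [t'] would gain the geometric factor [z ^ J], and the condensed series at [t'] would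
    converge. *)
Lemma dyadic_unbounded :
  ~ (\sum_(1 <= q <oo) (q%:R * r q `^ t')%:E < +oo)%E ->
  forall (M : R) (J0 : nat), exists2 J, (J0 <= J)%N & M <= 4 ^+ J * r (2 ^ J) `^ t.
Proof.
move=> div M J0; apply: contrapT => no; apply: div.
have small J : (J0 <= J)%N -> 4 ^+ J * r (2 ^ J) `^ t <= M.
  by move=> h; apply: ltW; rewrite ltNge; apply/negP => h'; apply: no; exists J.
have t0 := t_gt0; have r1 := r_gt0 (isT : (0 < 1)%N).
pose z : R := 4 `^ (t - t').
have z0 : 0 < z by rewrite powR_gt0.
have z1 : z < 1.
  have -> : z = (4 `^ (t' - t))^-1 by rewrite /z -powRN opprB.
  rewrite invf_lt1 ?powR_gt0//.
  suff : 1 `^ (t' - t) < 4 `^ (t' - t) :> R by rewrite powR1.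
  by apply: gt0_ltr_powR; rewrite ?subr_gt0 ?nnegrE ?ltr1n.
pose T : nat -> R := fun j => 4 ^+ j * r (2 ^ j) `^ t'.
have T0 j : 0 <= T j by rewrite mulr_ge0 ?exprn_ge0 ?powR_ge0.
pose C := `|M| * r 1 `^ (t' - t).
have C0 : 0 <= C by rewrite mulr_ge0 ?powR_ge0.
have TC j : (J0 <= j)%N -> T j <= C * z ^+ j.
  move=> hj; have J0' : (0 < 2 ^ j)%N by rewrite expn_gt0.
  have rj := r_gt0 J0'.
  have -> : T j = (4 ^+ j * r (2 ^ j) `^ t) * r (2 ^ j) `^ (t' - t).
    rewrite -mulrA -powRD; first by rewrite [t + _]addrC subrK.
    by rewrite (gt_eqF rj) implybT.
  have -> : C * z ^+ j = `|M| * (r 1 / 4 ^+ j) `^ (t' - t).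
    rewrite /C -mulrA powRM ?ltW ?invr_gt0 ?exprn_gt0//; congr (_ * (_ * _)).
    have -> : (4 ^+ j)^-1 = 4 `^ (- j%:R) :> R by rewrite powRN powR_mulrn.
    have -> : z ^+ j = z `^ j%:R by rewrite powR_mulrn// ltW.
    by rewrite /z -!powRrM; congr (_ `^ _); ring.
  apply: ler_pM.
  - by rewrite mulr_ge0 ?exprn_ge0 ?powR_ge0.
  - exact: powR_ge0.
  - by apply: le_trans (small _ hj) _; exact: ler_norm.
  have t''0 : 0 <= t' - t by rewrite subr_ge0 ltW.
  have r4 : 0 < r 1 / 4 ^+ j by rewrite divr_gt0// exprn_gt0.
  apply: ge0_ler_powR => //; rewrite ?nnegrE; try exact: ltW.
  have := r_mono2 (isT : (0 < 1)%N) J0'; rewrite expr1n mul1r.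
  by rewrite ler_pdivlMr ?exprn_gt0// natrX -exp4E mulrC.
have bound n : \sum_(0 <= j < n) T j <= \sum_(0 <= j < J0) T j + C * (1 / (1 - z)).
  apply: (@le_trans _ _ (\sum_(0 <= j < J0 + n) T j)).
    by rewrite addnC (big_cat_nat (leq0n n) (leq_addr J0 n))/= lerDl sumr_ge0.
  rewrite (big_cat_nat (leq0n J0) (leq_addr n J0))/= lerD2l.
  apply: (@le_trans _ _ (\sum_(J0 <= j < J0 + n) C * z ^+ j)).
    by apply: ler_sum_nat => j /andP[/TC].
  rewrite -mulr_sumr ler_wpM2l//.
  apply: le_trans (geometric_sum_le (J0 + n) _); last by rewrite ltW.
  by rewrite [leRHS](big_cat_nat (leq0n J0) (leq_addr n J0))/= lerDr sumr_ge0// => *; rewrite exprn_ge0// ltW.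
set B := _ + _ in bound.
apply: (@le_lt_trans _ _ (2 * B)%:E); last exact: ltry.
apply: bounded_summable => [n|n]; first by rewrite mulr_ge0 ?powR_ge0.
apply: (@le_trans _ _ (\sum_(1 <= q < 2 ^ n) q%:R * r q `^ t')).
  have nn : (n <= 2 ^ n)%N by rewrite ltnW// ltn_expl.
  case: n nn => [|n] nn; first by rewrite big_geq// sumr_ge0// => *; rewrite mulr_ge0 ?powR_ge0.
  by rewrite [leRHS](big_cat_nat (isT : (1 <= n.+1)%N) nn)/= lerDl sumr_ge0// => *; rewrite mulr_ge0 ?powR_ge0.
by apply: le_trans (sum_dyadic_powR_le n) _; rewrite ler_pM2l.
Qed.

End dyadic_divergence.

(** * From the hypotheses on real arguments to the theorem *)

Lemma near_pinfty_nat (R : realType) (P : R -> Prop) :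
  (\forall x \near +oo, P x) -> \forall n \near \oo, P n%:R.
Proof.
move=> [M [_ hM]]; near=> n; apply: hM.
have hn : (Num.bound `|M| <= n)%N by near: n; exact: nbhs_infty_ge.
apply: le_lt_trans (ler_norm M) _; apply: lt_le_trans (archi_boundP (normr_ge0 M)) _.
by rewrite ler_nat.
Unshelve. all: by end_near. Qed.

Lemma square_divisibility_inv (R : realType) (Psi : R -> R) (q : nat) :
  square_divisibility Psi -> (0 < q)%N -> 0 < Psi q%:R ->
  exists m : nat, Psi q%:R = 1 / (q%:R ^+ 2 * m%:R).
Proof.
move=> div q0 P0; have [n [Pn /dvdzP[z nz]]] := div q q0; exists (absz z).
have Q0 : 0 < q%:R :> R by rewrite ltr0n.
have e : (Psi q%:R)^-1 = z%:~R * q%:R ^+ 2.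
  by rewrite Pn nz rmorphM/= -pmulrn natrX.
have z0 : 0 < z.
  by rewrite -(ltr0z R) -(pmulr_lgt0 _ (exprn_gt0 2 Q0)) -e invr_gt0.
by rewrite natr_absz gtr0_norm// [_ ^+ 2 * _]mulrC -e div1r invrK.
Qed.

(** Relates the argument [1 / (8 * Psi q)] in the hypothesis on [omega] to [N = 1 / Psi q]. The
    constant becomes [45 / 16 * 64 = 180], above the 100 required by [r_ge]. *)
Lemma Psi_div8_ge (R : realType) (Psi : R -> R) (N : nat) x :
  nonincreasing_pos (fun x => x ^+ 2 * Psi x) -> 0 < x -> N%:R = 8 * x ->
  64 * Psi N%:R <= Psi x.
Proof.
move=> mono x0 Nx; have := mono x N%:R x0.
rewrite Nx => /(_ _)/=; have -> : x <= 8 * x by rewrite ler_peMl ?ler1n// ltW.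
move=> /(_ isT).
have -> : (8 * x) ^+ 2 * Psi (8 * x) = x ^+ 2 * (64 * Psi (8 * x)) by ring.
by rewrite ler_pM2l// exprn_gt0.
Qed.

Theorem theorem1p7 (R : realType) (Psi omega : R -> R)
  (Psi_gt0 : forall x, 0 < x -> 0 < Psi x)
  (omega_itv : forall x, 0 < x -> 0 < omega x < 1)
  (Psi_mono : nonincreasing_pos (fun x => x ^+ 2 * Psi x))
  (Psi_omega_mono : nonincreasing_pos (fun x => x ^+ 2 * Psi x * omega x))
  (Psi_div : square_divisibility Psi)
  (Psi_sum : (\sum_(1 <= q <oo) (q%:R * Psi q%:R)%:E < +oo)%E)
  (omega_lim : omega x @[x --> +oo] --> (0 : R))
  (omega_ge : \forall x \near +oo,
     45 / (16 * Psi x) * Psi (1 / (8 * Psi x)) <= omega x) :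
  hausdorff_dim (E_set Psi omega) =
  ereal_inf [set s%:E | s in
    [set s : R | 0 <= s /\
      (\sum_(1 <= q <oo) (q%:R * (Psi q%:R * omega q%:R) `^ s)%:E < +oo)%E]].
Proof.
pose psi (n : nat) := Psi n%:R.
pose r (n : nat) := Psi n%:R * omega n%:R.
have natR0 d : (0 < d)%N -> 0 < d%:R :> R by rewrite ltr0n.
have psi_gt0 d : (0 < d)%N -> 0 < psi d by move=> d0; exact/Psi_gt0/natR0.
have psi_mono d e : (0 < d)%N -> (d <= e)%N -> e%:R ^+ 2 * psi e <= d%:R ^+ 2 * psi d.
  by move=> d0 de; apply: Psi_mono; rewrite ?natR0// ler_nat.
have omega_gt0 d : (0 < d)%N -> 0 < omega d%:R by move=> /natR0/omega_itv/andP[].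
have r_gt0 d : (0 < d)%N -> 0 < r d by move=> d0; rewrite mulr_gt0 ?omega_gt0// psi_gt0.
have r_lt d : (0 < d)%N -> r d < psi d.
  move=> d0; have /andP[_ o1] := omega_itv _ (natR0 _ d0).
  by rewrite /r gtr_pMr// psi_gt0.
have r_mono2 d e : (0 < d)%N -> (d <= e)%N -> e%:R ^+ 2 * r e <= d%:R ^+ 2 * r d.
  by move=> d0 de; rewrite /r !mulrA; apply: Psi_omega_mono; rewrite ?natR0// ler_nat.
have r_mono d e : (0 < d)%N -> (d <= e)%N -> r e <= r d.
  by move=> d0 de; exact: (psi_le r_gt0 r_mono2).
have psi_div q : (0 < q)%N -> exists m : nat, psi q = 1 / (q%:R ^+ 2 * m%:R).
  by move=> q0; apply: square_divisibility_inv => //; exact: psi_gt0.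
have qpsi0 q : 0 <= q%:R * psi q.
  by case: q => [|q]; rewrite ?mul0r// mulr_ge0// ltW// psi_gt0.
have [S psi_sum] := summable_bounded qpsi0 Psi_sum.
have r_le : \forall q \near \oo, r q <= psi q / 4.
  have : \forall x \near +oo, omega x < 1 / 4.
    by apply: (cvgr_lt 0 omega_lim); rewrite divr_gt0.
  move=> /near_pinfty_nat h; near=> q.
  have q0 : (0 < q)%N by near: q; exact: nbhs_infty_gt.
  rewrite ler_pM2l ?psi_gt0// -div1r ltW//.
  by near: q.
have r_ge : \forall q \near \oo, forall N : nat, psi q * N%:R = 1 -> 100 * psi N <= r q.
  have h := near_pinfty_nat omega_ge; near=> q => N qN.
  have q0 : (0 < q)%N by near: q; exact: nbhs_infty_gt.
  have P0 := psi_gt0 _ q0.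
  have oq : 45 / (16 * Psi q%:R) * Psi (1 / (8 * Psi q%:R)) <= omega q%:R by near: q.
  have x0 : 0 < 1 / (8 * Psi q%:R) by rewrite divr_gt0// mulr_gt0.
  have NE : N%:R = 8 * (1 / (8 * Psi q%:R)).
    apply: (mulfI (lt0r_neq0 P0)); rewrite qN /psi; field.
    by rewrite lt0r_neq0.
  have N0 : 0 < N%:R :> R by rewrite NE mulr_gt0.
  have h64 := Psi_div8_ge Psi_mono x0 NE.
  have PN : 0 < Psi N%:R by exact: Psi_gt0.
  apply: (@le_trans _ _ (45 / 16 * (64 * Psi N%:R))).
    have -> : 45 / 16 * (64 * Psi N%:R) = 180 * psi N by rewrite /psi; field.
    by rewrite ler_pM2r// ler_nat.
  apply: (@le_trans _ _ (45 / 16 * Psi (1 / (8 * Psi q%:R)))).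
    by rewrite ler_pM2l// divr_gt0.
  apply: le_trans (_ : Psi q%:R * (45 / (16 * Psi q%:R) * Psi (1 / (8 * Psi q%:R))) <= _).
    rewrite le_eqVlt; apply/orP; left; apply/eqP; field.
    by rewrite lt0r_neq0.
  by rewrite ler_pM2l.
have upper s : 0 <= s -> (\sum_(1 <= q <oo) (q%:R * (Psi q%:R * omega q%:R) `^ s)%:E < +oo)%E ->
    hausdorff_measure s (E_set Psi omega) = 0%E.
  exact: (hausdorff_measure_E_set0 psi_gt0 psi_mono r_gt0 r_lt).
apply/eqP; rewrite eq_le; apply/andP; split.
  apply: le_ereal_inf => _ [s [s0 ss] <-]; exists s => //; split=> //; exact: upper.
apply: le_ereal_inf_tmp => _ [s [s0 Hs] <-].
rewrite leNgt; apply/negP; set s1 := ereal_inf _ => slt.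
(* At exponent 1 the series is dominated by the sum of [q * Psi q]; this later yields [t <= 1]. *)
have s1le1 : (s1 <= 1%:E)%E.
  apply: ereal_inf_lbound; exists 1 => //; split => //.
  apply: le_lt_trans (Psi_sum); apply: lee_nneseries => [q _ _|q _].
    by rewrite lee_fin mulr_ge0// powR_ge0.
  rewrite lee_fin; case: q => [|q]; first by rewrite !mul0r.
  by rewrite ler_pM2l ?natR0// powRr1 ltW// ?r_gt0// r_lt.
have s1fin : s1 \is a fin_num.
  rewrite fin_numE; apply/andP; split.
    by apply: contraTneq slt => ->; rewrite -leNgt leNye.
  by apply: contraTneq s1le1 => ->; rewrite -ltNge ltry.
move: slt s1le1; rewrite -(fineK s1fin) lte_fin lee_fin; set z := fine s1 => sz z1.
(* Two exponents strictly between [s] and the critical one: [null_cover] needs [s < t],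
   [dyadic_unbounded] needs [t < t'], and the series diverges at [t'] since [t' < z]. *)
pose t := s + (z - s) / 3; pose t' := s + 2 * ((z - s) / 3).
have zs : 0 < (z - s) / 3 by rewrite divr_gt0// subr_gt0.
have st : s < t by rewrite ltrDl.
have tt' : t < t' by rewrite ltrD2l ltr_pMl// ltr1n.
have t0 : 0 < t by exact: le_lt_trans st.
have t'z : t' < z by rewrite /t'; clear -zs; lra.
have t'0 : 0 <= t' by apply: ltW; exact: lt_trans tt'.
have t1 : t <= 1 by apply: ltW; apply: lt_trans tt' _; exact: lt_le_trans z1.
have div : ~ (\sum_(1 <= q <oo) (q%:R * r q `^ t')%:E < +oo)%E.
  move=> h; have : (s1 <= t'%:E)%E by apply: ereal_inf_lbound; exists t'.
  by rewrite -(fineK s1fin) lee_fin leNgt t'z.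
have big := dyadic_unbounded r_gt0 r_mono2 t0 tt' div.
have [e [q0 [e0 esc]]] := escape psi_gt0 psi_mono psi_sum psi_div r_gt0 r_lt r_mono
  r_le r_ge t0 t1 big.
have [U [d [EU d0 Ud dsum]]] := null_cover s0 st e0 Hs.
have [x [xU xW xE]] := esc U d d0 Ud dsum.
have : E_set Psi omega x.
  split => //; exists q0 => // q /= qq p.
  by have := xE q qq p; rewrite mulrBl mul1r [omega _ * _]mulrC.
by move=> /EU[i _]; exact: xU.
Unshelve. all: by end_near. Qed.
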